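(* Let $\mathfrak{g}$ be a real semisimple Lie algebra with Killing form $\kappa$, $R$ a skew-symmetric solution of the modified classical Yang-Baxter equation on $\mathfrak{g}$ with $c=1$ (split) or $c=i$ (non-split), $\gamma\in\mathbb{R}\setminus\{0\}$, and let the Lie group $G$ be equipped with the Sklyanin bracket $\{x_1,x_2\}_G=\gamma[R_{12},x_1x_2]$. Suppose $G$ acts by a Poisson-Lie action on a Poisson manifold $\mathcal{M}$ with non-abelian moment map $\Gamma:\mathcal{M}\to G^*$, and let $\Gamma^\pm$ be the associated maps defined in the context (with $(\Gamma^+,\Gamma^-)$ valued in $G_{DR}\subset G\times G$ if $c=1$, and $\Gamma^\pm$ valued in $G_\pm\subset G^{\mathbb{C}}$ if $c=i$). Then, for all sign choices, there are quantities $N^{++}_{12},N^{+-}_{12},N^{-+}_{12},N^{--}_{12}$, central for the Poisson bracket of $\mathcal{M}$, such that $$\{\Gamma^\pm_1,\Gamma^\pm_2\}=\gamma[R_{12},\Gamma^\pm_1\Gamma^\pm_2]+N^{\pm\pm}_{12}\Gamma^\pm_1\Gamma^\pm_2,\qquad \{\Gamma^\pm_1,\Gamma^\mp_2\}=\gamma[R^\pm_{12},\Gamma^\pm_1\Gamma^\mp_2]+N^{\pm\mp}_{12}\Gamma^\pm_1\Gamma^\mp_2,$$ and the infinitesimal action of $\epsilon\in\mathfrak{g}$ on $f\in C^\infty(\mathcal{M})$ is $$\delta_\epsilon f=-\frac{1}{2c\gamma}\,\kappa\Big(\epsilon,(\Gamma^+)^{-1}\{\Gamma^+,f\}-(\G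amma^-)^{-1}\{\Gamma^-,f\}\Big).$$
   Context: mCYBE: $[RX,RY]-R([RX,Y]+[X,RY])=-c^2[X,Y]$ for $X,Y\in\mathfrak{g}$; skew-symmetry is with respect to $\kappa$. $R^\pm=R\pm c\,\mathrm{Id}$; $R_{12}$ and $R^\pm_{12}=R_{12}\pm cC_{12}$ are the kernels with respect to $\kappa$ ($RY=\kappa_2(R_{12},Y_2)$, $C_{12}$ the quadratic Casimir). Subscripts $1,2$ are tensor-factor indices in matrix notation. A Poisson-Lie structure on $G$ induces a Lie bracket on $\mathfrak{g}^*$ by $[d_ef,d_eh]_*=d_e\{f,h\}_G$; $G^*$ is the connected simply connected Lie group with Lie algebra $(\mathfrak{g}^*,[\cdot,\cdot]_* )$. An action $G\times\mathcal{M}\to\mathcal{M}$ is Poisson-Lie if it is a Poisson map; its infinitesimal version is $\delta:\mathfrak{g}\to\mathrm{Vect}(\mathcal{M})$, a Lie algebra homomorphism, $[\delta_\epsilon,\delta_{\epsilon'}]=\delta_{[\epsilon,\epsilon']}$. $\Gamma:\mathcal{M}\to G^*$ is a non-abelian moment map if $\delta_\epsilon f=-\langle\epsilon,\Gamma^{-1}\{\Gamma,f\}\rangle$. For the Sklyanin bracket, $\pi:\mathfrak{g}_R\to\mathfrak{g}^*$, $\pi(X)=\kappa(X,\cdot)$, is a Lie algebra isomorphism, where $\mathfrak{g}_R$ is $\mathfrak{g}$ with bracket $[X,Y]_R=\gamma([RX,Y]+[X,RY])$. If $c=1$, $\Delta:\mathfrak{g}_R\to\mathfrak{g}\oplus\mathfrak{g}$,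 $X\mapsto\gamma(R^+X,R^-X)$, is an injective Lie homomorphism with image $\mathfrak{g}_{DR}$; if $c=i$, $\Delta_\pm=\gamma R^\pm:\mathfrak{g}_R\to\mathfrak{g}^{\mathbb{C}}$ are injective (real) Lie homomorphisms with images $\mathfrak{g}_\pm$. $G_{DR}\subset G\times G$ and $G_\pm\subset G^{\mathbb{C}}$ are the corresponding subgroups. Denoting lifts to groups by the same symbols, $(\Gamma^+,\Gamma^-)=\Delta\circ\pi^{-1}(\Gamma)$ if $c=1$, and $\Gamma^\pm=\Delta_\pm\circ\pi^{-1}(\Gamma)$ if $c=i$. ''Central'' means the components Poisson commute with all functions on $\mathcal{M}$; the $N$'s take values in $\mathfrak{g}\otimes\mathfrak{g}$ (resp. $\mathfrak{g}^{\mathbb{C}}\otimes\mathfrak{g}^{\mathbb{C}}$). *)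

(* Defs.v *)
From HB Require Import structures.
From mathcomp Require Import all_boot all_order all_algebra.
From mathcomp Require Import complex mxtens.
From mathcomp Require Import all_classical all_reals all_analysis.

Set Implicit Arguments.
Unset Strict Implicit.
Unset Printing Implicit Defensive.

Import Order.TTheory GRing.Theory Num.Theory.
Import numFieldNormedType.Exports.
Local Open Scope classical_set_scope.
Local Open Scope ring_scope.

Section Smooth.
Context {R : realType}.

(* Only used on open subsets of finite-dimensional spaces. *)
Fixpoint Ck {V W : normedModType R} (k : nat) (U : set V) (f : V -> W) : Prop :=
  if k is k'.+1 then
    (forall x, U x -> differentiable f x) /\
    (forall v : V, Ck k' U (fun x => 'D_v f x))
  else forall x, U x -> {for x, continuous f}.

Definition smooth_on {V W : normedModType R} (U : set V) (f : V -> W) : Prop :=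
  forall k, Ck k U f.

Record chart (T : topologicalType) (E : normedModType R) := Chart {
  dom : set T;
  cod : set E;
  cmap : T -> E;
  cinv : E -> T }.

Definition is_chart (T : topologicalType) (E : normedModType R)
    (c : chart T E) : Prop :=
  [/\ open (dom c) /\ open (cod c),
      forall x, dom c x -> cod c (cmap c x) /\ cinv c (cmap c x) = x,
      forall u, cod c u -> dom c (cinv c u) /\ cmap c (cinv c u) = u,
      {within dom c, continuous (cmap c)} &
      {within cod c, continuous (cinv c)}].

Definition prod_chart (T T' : topologicalType) (E E' : normedModType R)
    (c : chart T E) (c' : chart T' E') : chart (T * T')%type (E * E')%type :=
  Chart (dom c `*` dom c') (cod c `*` cod c')
    (fun p => (cmap c p.1, cmap c' p.2)) (fun u => (cinv c u.1, cinv c' u.2)).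

Definition prod_atlas (T T' : topologicalType) (E E' : normedModType R)
    (A : set (chart T E)) (A' : set (chart T' E')) :
    set (chart (T * T')%type (E * E')%type) :=
  [set d | exists c c', [/\ A c, A' c' & d = prod_chart c c']].

Definition transition (T T' : topologicalType) (E E' : normedModType R)
    (F : T -> T') (c : chart T E) (d : chart T' E') : Prop :=
  smooth_on [set u | cod c u /\ dom d (F (cinv c u))]
    (fun u => cmap d (F (cinv c u))).

Definition smooth_map (T T' : topologicalType) (E E' : normedModType R)
    (A : set (chart T E)) (B : set (chart T' E')) (F : T -> T') : Prop :=
  continuous F /\ forall c d, A c -> B d -> transition F c d.

Record smoothStructure (T : topologicalType) := SmoothStructure {
  mdim : nat;
  atlas : set (chart T 'rV[R]_mdim);
  atlas_chart : forall c, atlas c -> is_chart c;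
  atlas_cover : forall x, exists2 c, atlas c & dom c x;
  atlas_compat : forall c d, atlas c -> atlas d -> transition id c d;
  mhausdorff : hausdorff_space T;
  msecond_countable : @second_countable T }.

Arguments atlas {T} s _.

Definition cinfty (T : topologicalType) (A : smoothStructure T)
    (f : T -> R) : Prop :=
  forall c, atlas A c -> smooth_on (cod c) (fun u => f (cinv c u) : R^o).

(* A tangent vector is a functional on C^oo(T); its values on functions that
   are not smooth are irrelevant. *)
Definition tangent (T : topologicalType) (A : smoothStructure T) (p : T)
    (D : (T -> R) -> R) : Prop :=
  exists c (v : 'rV[R]_(mdim A)),
    [/\ atlas A c, dom c p &
        forall h, cinfty A h ->
          D h = 'D_v (fun u => h (cinv c u) : R^o) (cmap c p)].

Definition simply_connected (T : topologicalType) : Prop :=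
  connected [set: T] /\
  forall l : R -> T, {within `[0, 1], continuous l} -> l 0 = l 1 ->
    exists H : R * R -> T,
      {within `[0, 1] `*` `[0, 1], continuous H} /\
      forall t, t \in `[0, 1] ->
        [/\ H (0, t) = l t, H (1, t) = l 0, H (t, 0) = l 0 & H (t, 1) = l 0].

End Smooth.

Arguments smoothStructure R T : clear implicits.
Arguments atlas {R T} s _.

#[short(type="topGroupType")]
HB.structure Definition TopGroup := {G of Topological G & Group G}.

Section LieAlgebra.
Context {R : realType} {g : vectType R}.
Variable br : g -> g -> g.

Definition lie_bracket : Prop :=
  [/\ forall X, linear (br X),
      forall X, br X X = 0 &
      forall X Y Z, br X (br Y Z) + br Y (br Z X) + br Z (br X Y) = 0].

Definition semisimple : Prop :=
  forall I : {vspace g},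
    (forall X Y, Y \in I -> br X Y \in I) ->
    (forall X Y, X \in I -> Y \in I -> br X Y = 0) ->
    I = 0%VS.

Definition bas (i : 'I_(\dim {:g})) : g := (vbasis {:g})`_i.

Definition killing (X Y : g) : R :=
  \sum_i coord (vbasis {:g}) i (br X (br Y (bas i))).

Definition skew_symmetric (A : 'End(g)) : Prop :=
  forall X Y, killing (A X) Y = - killing X (A Y).

(* c2 stands for c^2. *)
Definition mCYBE (c2 : R) (A : 'End(g)) : Prop :=
  forall X Y,
    br (A X) (A Y) - A (br (A X) Y + br X (A Y)) = - (c2 *: br X Y).

(* T encodes T_12 = \sum_(i, j) T i j e_i (x) e_j, with e_i = bas i;
   A Y = kappa_2(T_12, Y_2). *)
Definition kernel_of (A : 'End(g)) (T : 'M[R]_(\dim {:g})) : Prop :=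
  forall Y, A Y = \sum_i \sum_j (T i j * killing (bas j) Y) *: bas i.

Definition kappa_dual (X : g) : 'Hom(g, R^o) :=
  linfun (fun Y => killing X Y : R^o).

(* The complexification of g: the pair (X, Y) stands for X + iY. *)
Definition brC (Z W : g * g) : g * g :=
  (br Z.1 W.1 - br Z.2 W.2, br Z.1 W.2 + br Z.2 W.1).

Definition killingC (Z W : g * g) : R[i] :=
  Complex (killing Z.1 W.1 - killing Z.2 W.2)
          (killing Z.1 W.2 + killing Z.2 W.1).

End LieAlgebra.

Definition timesI {V : zmodType} (Z : V * V) : V * V := (- Z.2, Z.1).

Section LieGroup.
Context {R : realType}.

Definition lie_group (G : topGroupType) (A : smoothStructure R G) : Prop :=
  smooth_map (prod_atlas (atlas A) (atlas A)) (atlas A)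
    (fun p : G * G => (p.1 * p.2)%g) /\
  smooth_map (atlas A) (atlas A) (fun x : G => x^-1%g).

(* lam identifies (k, br) with the tangent space of G at 1, whose bracket is
   that of the left-invariant vector fields x |-> (h |-> lam X (h (x * _))). *)
Definition lie_algebra_of (G : topGroupType) (A : smoothStructure R G)
    (k : vectType R) (br : k -> k -> k) (lam : k -> (G -> R) -> R) : Prop :=
  [/\ forall X, tangent A 1%g (lam X),
      forall D, tangent A 1%g D ->
        exists X, forall h, cinfty A h -> D h = lam X h,
      forall X Y, (forall h, cinfty A h -> lam X h = lam Y h) -> X = Y,
      forall (a : R) X Y h, cinfty A h ->
        lam (a *: X + Y) h = a * lam X h + lam Y h &
      forall X Y h, cinfty A h ->
        lam (br X Y) h = lam X (fun x => lam Y (fun y => h (x * y)%g))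
                       - lam Y (fun x => lam X (fun y => h (x * y)%g))].

Definition lie_group_hom (G H : topGroupType) (A : smoothStructure R G)
    (B : smoothStructure R H) (Phi : G -> H) : Prop :=
  smooth_map (atlas A) (atlas B) Phi /\
  forall x y, Phi (x * y)%g = (Phi x * Phi y)%g.

(* (k, br) = g^C and multiplication by i extends to a bi-invariant complex
   structure: Ad_x is C-linear for every x. *)
Definition complex_group (G : topGroupType) (A : smoothStructure R G)
    (g : vectType R) (lam : g * g -> (G -> R) -> R) : Prop :=
  forall x Z W,
    (forall h, cinfty A h ->
       lam Z (fun y => h (x * y * x^-1)%g) = lam W h) ->
    forall h, cinfty A h ->
       lam (timesI Z) (fun y => h (x * y * x^-1)%g) = lam (timesI W) h.

Record poisson (M : topologicalType) (A : smoothStructure R M) := Poisson {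
  pb :> (M -> R) -> (M -> R) -> M -> R;
  pb_smooth : forall f h, cinfty A f -> cinfty A h -> cinfty A (pb f h);
  pb_skew : forall f h, cinfty A f -> cinfty A h ->
    forall m, pb f h m = - pb h f m;
  pb_linear : forall (a : R) f1 f2 h,
    cinfty A f1 -> cinfty A f2 -> cinfty A h ->
    forall m, pb (fun y => a * f1 y + f2 y) h m = a * pb f1 h m + pb f2 h m;
  pb_leibniz : forall f1 f2 h, cinfty A f1 -> cinfty A f2 -> cinfty A h ->
    forall m, pb (fun y => f1 y * f2 y) h m
            = f1 m * pb f2 h m + pb f1 h m * f2 m;
  pb_jacobi : forall f1 f2 f3, cinfty A f1 -> cinfty A f2 -> cinfty A f3 ->
    forall m, pb f1 (pb f2 f3) m + pb f2 (pb f3 f1) m + pb f3 (pb f1 f2) m = 0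
}.

Definition central (M : topologicalType) (A : smoothStructure R M)
    (P : poisson A) (n : M -> R) : Prop :=
  cinfty A n /\ forall f, cinfty A f -> forall m, P n f m = 0.

(* [d_1 f, d_1 h]_* = d_1 {f, h} *)
Definition dual_bracket (G : topGroupType) (A : smoothStructure R G)
    (P : poisson A) (g : vectType R) (lam : g -> (G -> R) -> R)
    (brs : 'Hom(g, R^o) -> 'Hom(g, R^o) -> 'Hom(g, R^o)) : Prop :=
  forall f h (a b : 'Hom(g, R^o)), cinfty A f -> cinfty A h ->
    (forall X, a X = lam X f) -> (forall X, b X = lam X h) ->
    forall X, brs a b X = lam X (P f h).

(* The last clause says that the action is a Poisson map for the product bracket
   on G x M.  Both left and right actions are allowed. *)
Definition poisson_lie_action (G : topGroupType) (AG : smoothStructure R G)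
    (PG : poisson AG) (M : topologicalType) (AM : smoothStructure R M)
    (PM : poisson AM) (is_left : bool) (act : G -> M -> M) : Prop :=
  [/\ smooth_map (prod_atlas (atlas AG) (atlas AM)) (atlas AM)
        (fun p : G * M => act p.1 p.2),
      forall m, act 1%g m = m,
      forall x y m, act (x * y)%g m =
        if is_left then act x (act y m) else act y (act x m) &
      forall f h, cinfty AM f -> cinfty AM h -> forall x m,
        PM f h (act x m) =
          PG (fun y => f (act y m)) (fun y => h (act y m)) x
          + PM (fun p => f (act x p)) (fun p => h (act x p)) m].

(* delta_eps f, with the sign that makes eps |-> delta_eps a Lie algebra homomorphism:
   d/dt f (exp(-t eps) . m) for a left action, d/dt f (m . exp(t eps)) for a
   right action. *)
Definition inf_action (G : topGroupType) (M : Type) (g : vectType R)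
    (lam : g -> (G -> R) -> R) (is_left : bool) (act : G -> M -> M)
    (eps : g) (f : M -> R) (m : M) : R :=
  lam eps (fun x => f (act (if is_left then x^-1%g else x) m)).

(* X = F(m)^-1 {F, f}(m), as an element of the Lie algebra of K. *)
Definition left_log (M : topologicalType) (AM : smoothStructure R M)
    (PM : poisson AM) (K : topGroupType) (AK : smoothStructure R K)
    (k : vectType R) (lam : k -> (K -> R) -> R)
    (F : M -> K) (f : M -> R) (m : M) (X : k) : Prop :=
  forall h, cinfty AK h ->
    lam X h = PM (fun p => h ((F m)^-1 * F p)%g) f m.

Definition moment_map (M : topologicalType) (AM : smoothStructure R M)
    (PM : poisson AM) (Gs : topGroupType) (AGs : smoothStructure R Gs)
    (g : vectType R) (lams : 'Hom(g, R^o) -> (Gs -> R) -> R)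
    (delta : g -> (M -> R) -> M -> R) (Gam : M -> Gs) : Prop :=
  smooth_map (atlas AM) (atlas AGs) Gam /\
  forall f, cinfty AM f -> forall m,
    exists2 eta, left_log PM AGs lams Gam f m eta &
      forall eps, delta eps f m = - eta eps.

Definition rep (K : topGroupType) (A : smoothStructure R K) (n : nat)
    (rho : K -> 'M[R[i]]_n) : Prop :=
  [/\ rho 1%g = 1%:M,
      forall x y, rho (x * y)%g = rho x *m rho y &
      forall i j, cinfty A (fun x => complex.Re (rho x i j)) /\
                  cinfty A (fun x => complex.Im (rho x i j))].

Definition drep (K : topGroupType) (k : vectType R) (lam : k -> (K -> R) -> R)
    (n : nat) (rho : K -> 'M[R[i]]_n) (X : k) : 'M[R[i]]_n :=
  \matrix_(i, j) Complex (lam X (fun x => complex.Re (rho x i j)))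
                         (lam X (fun x => complex.Im (rho x i j))).

Definition pbC (M : topologicalType) (A : smoothStructure R M) (P : poisson A)
    (f h : M -> R[i]) (m : M) : R[i] :=
  let fr x := complex.Re (f x) in let fi x := complex.Im (f x) in
  let hr x := complex.Re (h x) in let hi x := complex.Im (h x) in
  Complex (P fr hr m - P fi hi m) (P fr hi m + P fi hr m).

(* {F_1, H_2} = \sum {F_ij, H_kl} E_ij (x) E_kl *)
Definition pb12 (M : topologicalType) (A : smoothStructure R M) (P : poisson A)
    (n : nat) (F H : M -> 'M[R[i]]_n) (m : M) : 'M[R[i]]_(n * n) :=
  \sum_i \sum_j \sum_k \sum_l
    pbC P (fun x => F x i j) (fun x => H x k l) m
      *: (delta_mx i j *t delta_mx k l).

Definition leg1 (n : nat) (X : 'M[R[i]]_n) : 'M[R[i]]_(n * n) := X *t 1%:M.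
Definition leg2 (n : nat) (X : 'M[R[i]]_n) : 'M[R[i]]_(n * n) := 1%:M *t X.

Definition commx (n : nat) (X Y : 'M[R[i]]_n) : 'M[R[i]]_n := X *m Y - Y *m X.

(* The matrix of \sum_(i, j) T i j e_i (x) e_j when e_i acts by E i. *)
Definition tensor (d n : nat) (E : 'I_d -> 'M[R[i]]_n) (T : 'M[R[i]]_d) :
    'M[R[i]]_(n * n) :=
  \sum_i \sum_j T i j *: (E i *t E j).

Definition complexify (d : nat) (T : 'M[R]_d) : 'M[R[i]]_d :=
  map_mx (real_complex R) T.

(* For semisimple g this, applied to the adjoint representation alone, already
   determines the Poisson bivector of G. *)
Definition sklyanin (G : topGroupType) (A : smoothStructure R G)
    (P : poisson A) (g : vectType R) (lam : g -> (G -> R) -> R)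
    (gam : R) (R12 : 'M[R]_(\dim {:g})) : Prop :=
  forall n (rho : G -> 'M[R[i]]_n), rep A rho -> forall x,
    pb12 P rho rho x =
      (real_complex R gam) *:
        commx (tensor (fun i => drep lam rho (bas i)) (complexify R12))
              (leg1 (rho x) *m leg2 (rho x)).

(* Signs: true is +, false is -. *)
Definition sgn {S : pzRingType} (s : bool) : S := if s then 1 else -1.

(* The four relations; for equal signs the kernel is R12, for signs (s, -s) it
   is R12 + s c C12. *)
Definition exchange_relations (M : topologicalType) (A : smoothStructure R M)
    (P : poisson A) (d n : nat) (c : R[i]) (gam : R) (R12 C12 : 'M[R]_d)
    (E : 'I_d -> 'M[R[i]]_n) (F : bool -> M -> 'M[R[i]]_n)
    (N : bool -> bool -> M -> 'M[R[i]]_d) : Prop :=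
  forall (s t : bool) (m : M),
    let r := if s == t then complexify R12
             else complexify R12 + (sgn s * c) *: complexify C12 in
    pb12 P (F s) (F t) m =
      (real_complex R gam) *:
        commx (tensor E r) (leg1 (F s m) *m leg2 (F t m))
      + tensor E (N s t m) *m leg1 (F s m) *m leg2 (F t m).

End LieGroup.

(* Main.v *)
Require Import Defs.
From HB Require Import structures.
From mathcomp Require Import all_boot all_order all_algebra.
From mathcomp Require Import complex mxtens.
From mathcomp Require Import all_classical all_reals all_analysis.
From mathcomp Require Import perm ring.

Set Implicit Arguments.
Unset Strict Implicit.
Unset Printing Implicit Defensive.

Import Order.TTheory GRing.Theory Num.Theory.
Import numFieldNormedType.Exports.
Local Open Scope classical_set_scope.
Local Open Scope ring_scope.

(** Write D_i f for the components of kappa^-1 (Gamma^-1 {Gamma, f}) in g.  The moment map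
    property says D_i f = - delta_{e^i} f, with (e^i) the kappa-dual basis, and pushing
    Gamma through Gamma^+- gives
      {a o Gamma^s, f} = \sum_i (D_i f) (x^s_i a) o Gamma^s,   x^s_i = gamma (R + s c) e_i,
    for every smooth function a; the formula for delta follows from the difference of the
    two signs.  Taking f = b o Gamma^t, skew-symmetry forces
      {a o Gamma^s, b o Gamma^t} = \sum_(i, j) P_ij (x^s_i a) (x^t_j b)
    with one function P : M -> g (x) g for all signs.  The Jacobi identity and
    [delta_X, delta_Y] = delta_[X, Y] give {P, f} as an affine function of P, and
      N = Ad_(Gamma^s) (x) Ad_(Gamma^t) (P^{st} + gamma r^{st}) - gamma r^{st}
    is central because, by the modified Yang-Baxter equation, the inhomogeneous term is
    the adjoint action on gamma r^{st}.  Evaluating the bracket formula on the entries of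
    a representation gives the exchange relations. *)

(** * Calculus of C^k functions *)

(** The tensor P is built on the dual group, before any sign is chosen. There the vectors kappa(e_i,
    .) form a basis, so the coefficients of a bracket are determined; the homomorphisms Phi^s then
    change only the vectors x^s_i, never P. This order matters: for c = 1 the map R + s c may have a
    kernel, the x^s_i may be dependent, and the Jacobi identity for pullbacks along Gamma^s and
    Gamma^t fixes {P, f} only after contraction with x^s and x^t. That contraction, P^{st}, is all
    that N contains. The left logarithmic derivative places P^{st} to the right of Gamma_1 Gamma_2.
    Conjugation by Ad moves it to the left, and -gamma r^{st}, a stationary point of the affine law
    for P^{st}, produces the commutator. The shift s c C_12 for opposite signs is the multiple of
    the Casimir that makes -gamma r^{st} stationary. Brackets are taken of global smooth functions,
    and local coordinates are not such functions. Their role is played by smooth functions on a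
    group with prescribed differentials at 1; quantities defined point by point are shown to be
    smooth by Cramer's rule. *)

Section Calculus.
Context {R : realType}.
Implicit Types E F : normedModType R.

(** The difference [h - f] vanishes near [x], so its differential is zero and [h] is a sum of two
    differentiable maps. *)
Lemma near_eq_differentiable E F (f h : E -> F) (x : E) :
  {near x, f =1 h} -> differentiable f x -> differentiable h x.
Proof.
move=> fh df; pose k := h - f.
have k0 : \forall y \near x, k y = 0.
  by apply: filterS fh => y fy; rewrite /k !fctE fy subrr.
suff dk : differentiable k x.
  rewrite (_ : h = f + k); first exact: differentiableD.
  by apply/funext => y; rewrite /k !fctE addrC subrK.
have H : k \o shift x = cst (k x) + (\0 : {linear E -> F}) +o_ 0 id.
  apply/eqaddoP => e e0; rewrite (nbhs_singleton k0).
  have : \forall y \near (0 : E), k (y + x) = 0.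
    by move: k0; rewrite (near_shift 0 x); apply: filterS => y; rewrite /= subr0.
  apply: filterS => y /= ky.
  suff -> : (k \o +%R^~ x - (cst 0 + \0)) y = 0 by rewrite normr0 mulr_ge0 // ltW.
  by rewrite -[LHS]/(k (y + x) - (0 + 0)) ky addr0 subrr.
have c0 : continuous (\0 : {linear E -> F}) by move=> y; exact: cvg_cst.
apply/diff_locallyP; rewrite (diff_unique c0 H); split => //.
Qed.

Lemma Ck_mono E F k (U : set E) (f : E -> F) : Ck k.+1 U f -> Ck k U f.
Proof.
elim: k f => [|k IH] f [df Hf].
  by move=> x Ux; exact/differentiable_continuous/df.
by split => // v; apply: IH; exact: Hf.
Qed.

Lemma Ck_sub E F k (U V : set E) (f : E -> F) : U `<=` V -> Ck k V f -> Ck k U f.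
Proof.
move=> UV; elim: k f => [|k IH] f /=; first by move=> H x /UV; exact: H.
by move=> [df Hf]; split=> [x /UV /df//|v]; exact: IH.
Qed.

Lemma Ck_cover E F k (U : set E) (f : E -> F) :
  (forall x, U x -> exists2 V : set E, V x & Ck k V f) -> Ck k U f.
Proof.
elim: k f => [|k IH] f H; first by move=> x /H [V Vx]; apply.
split=> [x /H [V Vx [df _]]|v]; first exact: df.
by apply: IH => x /H [V Vx [_ Hf]]; exists V; last exact: Hf.
Qed.

Lemma near_open_eq (T : topologicalType) (T' : Type) (U : set T) (f h : T -> T') (x : T) :
  open U -> (forall x, U x -> f x = h x) -> U x -> {near x, f =1 h}.
Proof.
move=> oU fh Ux.
by apply: (filterS (P := U)) => [y /fh//|]; exact: open_nbhs_nbhs.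
Qed.

(** Openness of [U] turns equality on [U] into equality near each of its points, which is what
    differentiability and ['D_v] depend on. *)
Lemma Ck_ext E F k (U : set E) (f h : E -> F) : open U ->
  (forall x, U x -> f x = h x) -> Ck k U f -> Ck k U h.
Proof.
move=> oU; elim: k f h => [|k IH] f h fh /=.
  move=> cf x Ux; suff: h @ x --> h x by [].
  rewrite -(fh x Ux); apply: cvg_trans (cf x Ux); apply: near_eq_cvg.
  exact: (near_open_eq oU fh Ux).
move=> [df Hf]; split=> [x Ux|v].
  by apply: near_eq_differentiable (df x Ux); exact: (near_open_eq oU fh Ux).
apply: IH (Hf v) => x Ux; apply: near_eq_derive.
exact: (near_open_eq oU fh Ux).
Qed.

Lemma Ck_cst E F k (U : set E) (a : F) : Ck k U (fun _ : E => a).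
Proof.
elim: k a => [|k IH] a /=; first by move=> x _; exact: cvg_cst.
split=> [x _|v]; first exact: differentiable_cst.
suff -> : (fun x => 'D_v (fun _ : E => a) x) = (fun=> 0) by exact: IH.
by apply/funext => x; exact: derive_cst.
Qed.

Lemma CkD E F k (U : set E) (f h : E -> F) : open U ->
  Ck k U f -> Ck k U h -> Ck k U (fun x => f x + h x).
Proof.
move=> oU; elim: k f h => [|k IH] f h /=.
  by move=> cf ch x Ux; apply: cvgD; [exact: cf|exact: ch].
move=> [df Hf] [dh Hh]; split=> [x Ux|v].
  by apply: (@differentiableD _ _ _ f h); [exact: df|exact: dh].
apply: Ck_ext (IH _ _ (Hf v) (Hh v)) => // x Ux.
by rewrite (@deriveD _ _ _ f h) //; apply: diff_derivable; [exact: df|exact: dh].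
Qed.

Lemma CkM E k (U : set E) (f h : E -> R^o) : open U ->
  Ck k U f -> Ck k U h -> Ck k U (fun x => f x * h x : R^o).
Proof.
move=> oU; elim: k f h => [|k IH] f h /=.
  by move=> cf ch x Ux; apply: cvgM; [exact: cf|exact: ch].
move=> Hf Hh; have Cf := Ck_mono Hf; have Ch := Ck_mono Hh.
move: Hf Hh => [df Hf] [dh Hh]; split=> [x Ux|v].
  by apply: (@differentiableM _ _ f h); [exact: df|exact: dh].
apply: Ck_ext (CkD oU (IH _ _ Cf (Hh v)) (IH _ _ Ch (Hf v))) => // x Ux.
by rewrite (@deriveM _ _ f h) //; apply: diff_derivable; [exact: df|exact: dh].
Qed.

Lemma CkV E k (U : set E) (f : E -> R^o) : open U ->
  (forall x, U x -> f x != 0) -> Ck k U f -> Ck k U (fun x => (f x)^-1 : R^o).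
Proof.
move=> oU f0; elim: k => [|k IH] /=.
  by move=> cf x Ux; apply: cvgV; [exact: f0|exact: cf].
move=> Hf; have Cf := Ck_mono Hf.
move: Hf => [df Hf]; split=> [x Ux|v].
  by apply: (@differentiableV _ _ f); [exact: df|exact: f0].
have C2 := CkM oU (IH Cf) (IH Cf).
apply: Ck_ext (CkM oU (CkM oU (Ck_cst k U (-1 : R^o)) C2) (Hf v)) => // x Ux.
rewrite (@deriveV _ _ f) //; [|exact: f0|exact/diff_derivable/df].
by rewrite /GRing.scale /= mulN1r expr2 invfM.
Qed.

Lemma Ck_sum E F (I : Type) (r : seq I) k (U : set E) (f : I -> E -> F) : open U ->
  (forall i, Ck k U (f i)) -> Ck k U (fun x => \sum_(i <- r) f i x).
Proof.
move=> oU H; elim: r => [|i r IH].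
  by under eq_fun do rewrite big_nil; exact: Ck_cst.
by under eq_fun do rewrite big_cons; exact: CkD.
Qed.

Lemma derivative_comp_row E n (phi : E -> 'rV[R]_n) (f : 'rV[R]_n -> R^o) (x v : E) :
  differentiable phi x -> differentiable f (phi x) ->
  'D_v (f \o phi) x = \sum_i 'D_v (fun y => phi y 0 i : R^o) x * 'D_(delta_mx 0 i) f (phi x).
Proof.
move=> dphi df; rewrite deriveE; last exact: differentiable_comp.
rewrite diff_comp //= -(deriveE v dphi).
rewrite derive_mx; last exact: diff_derivable.
set w := \matrix_(i, j) _.
rewrite [w]row_sum_delta linear_sum; apply: eq_bigr => i _.
by rewrite linearZ /= -deriveE // /w mxE.
Qed.

Lemma Ck_coord E n k (U : set E) (phi : E -> 'rV[R]_n) (i : 'I_n) : open U ->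
  Ck k U phi -> Ck k U (fun x => phi x 0 i : R^o).
Proof.
move=> oU; elim: k phi => [|k IH] phi /=.
  move=> cp x Ux; apply: (@continuous_comp _ _ _ phi (fun y : 'rV_n => y 0 i : R^o)).
    exact: cp.
  exact: (@coord_continuous R 1 n 0 i (phi x)).
move=> [dp Hp]; split=> [x Ux|v].
  apply: (@differentiable_comp _ _ _ _ phi (fun y : 'rV_n => y 0 i : R^o)).
    exact: dp.
  exact: (@differentiable_coord R 1 n (phi x) 0 i).
apply: Ck_ext (IH _ (Hp v)) => // x Ux.
by rewrite derive_mx ?mxE //; exact/diff_derivable/dp.
Qed.

(** In a row space the chain rule is a finite sum of products: a derivative of a coordinate of [phi]
    times a partial derivative of [f] composed with [phi]. The second factor falls under the
    induction hypothesis because [f] is generalized. *)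
Lemma Ck_comp_row E n k (U : set E) (V : set 'rV[R]_n) (phi : E -> 'rV[R]_n)
    (f : 'rV[R]_n -> R^o) : open U -> (forall x, U x -> V (phi x)) ->
  Ck k U phi -> Ck k V f -> Ck k U (f \o phi).
Proof.
move=> oU UV; elim: k f => [|k IH] f.
  by move=> /= cp cf x Ux; apply: (@continuous_comp _ _ _ phi f); [exact: cp|exact/cf/UV].
move=> Hphi Hf; have Cphi := Ck_mono Hphi; have Cf := Ck_mono Hf.
have Hc i := Ck_coord i oU Hphi.
move: Hf Hphi => [df Hf] [dphi _]; split=> [x Ux|v].
  by apply: differentiable_comp; [exact: dphi|exact/df/UV].
pose t i x := 'D_v (fun y => phi y 0 i : R^o) x * 'D_(delta_mx 0 i) f (phi x) : R^o.
have H i : Ck k U (t i).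
  apply: CkM => //; first by case: (Hc i) => _; apply.
  exact: IH (Hf (delta_mx 0 i)).
apply: Ck_ext (Ck_sum (index_enum 'I_n) oU H) => // x Ux.
by rewrite (derivative_comp_row v (dphi x Ux)) //; apply: df; exact: UV.
Qed.

(** The two difference quotients are equal for every [h], so nothing has to be known about their
    limits. *)
Lemma derive_affine E E' F (f : E' -> F) (io : E -> E') (v : E) (w : E') (x : E) :
  (forall (h : R) y, io (h *: v + y) = h *: w + io y) ->
  'D_v (f \o io) x = 'D_w f (io x).
Proof.
move=> io_affine; rewrite /derive; apply: (congr1 (fun g : R -> F => lim (g @ 0^'))).
by apply/funext => h /=; rewrite io_affine.
Qed.

(** Serves the slices [u |-> (u, w)]: their target is a product and not a row space, so
    [Ck_comp_row] does not cover them. *)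
Lemma Ck_affine E E' F k (U : set E) (V : set E') (f : E' -> F) (io : E -> E') (l : E -> E') :
  (forall (h : R) v y, io (h *: v + y) = h *: l v + io y) ->
  (forall x, differentiable io x) ->
  (forall x, U x -> V (io x)) -> Ck k V f -> Ck k U (f \o io).
Proof.
move=> io_affine dio UV; elim: k f => [|k IH] f /=.
  move=> cf x Ux; apply: (@continuous_comp _ _ _ io f); last exact/cf/UV.
  exact: differentiable_continuous.
move=> [df Hf]; split=> [x Ux|v].
  by apply: differentiable_comp => //; exact/df/UV.
suff -> : (fun x => 'D_v (f \o io) x) = (fun y => 'D_(l v) f y) \o io by exact: IH.
by apply/funext => x /=; exact: derive_affine.
Qed.

End Calculus.

(** * Symmetry of second derivatives *)

Section Schwarz.
Context {R : realType} {E : normedModType R}.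

Lemma derive_shiftl (F : E -> R^o) (b a u : E) :
  'D_u (fun y => F (b + y)) a = 'D_u F (b + a).
Proof.
by apply: (@derive_affine R E E R^o F (fun y => b + y)) => h y; rewrite addrCA.
Qed.

Lemma differentiable_shiftl (F : E -> R^o) (b a : E) :
  differentiable F (b + a) -> differentiable (fun y => F (b + y)) a.
Proof.
by move=> dF; apply: (@differentiable_comp _ _ _ _ (fun y => b + y) F).
Qed.

Lemma MVT_line (F : E -> R^o) (a u : E) (h : R) : 0 <= h ->
  (forall s, s \in `[0, h] -> differentiable F (s *: u + a)) ->
  exists2 xi, xi \in `[0, h] & F (h *: u + a) - F a = 'D_u F (xi *: u + a) * h.
Proof.
move=> h0 dF.
pose io (s : R) := s *: u + a.
have dio s : differentiable io s.
  exact: (@differentiableD _ _ _ (fun s : R => s *: u) (cst a)).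
have dG s : s \in `[0, h] -> differentiable (F \o io) s.
  by move=> sI; apply: differentiable_comp => //; exact: dF.
have [||xi xiI exi] := @MVT_segment R (F \o io) (fun s => 'D_u F (s *: u + a)) 0 h h0.
- move=> s sI.
  have sI' : s \in `[0, h] by apply: subset_itv_oo_cc sI.
  apply: DeriveDef; first exact/diff_derivable/dG.
  by apply: derive_affine => k y; rewrite /io -[k%:A]/(k * 1) mulr1 scalerDl addrA.
- apply: continuous_in_subspaceT => s; rewrite inE => sI.
  exact/differentiable_continuous/dG.
move: exi; rewrite /= /io scale0r add0r subr0 => e.
by exists xi.
Qed.

(** The mean value theorem is applied twice: along [v] to [y |-> f (h *: w + y) - f y], then along
    [w] to ['D_v f]. *)
Lemma second_difference (f : E -> R^o) (U : set E) (x v w : E) (h : R) : 0 <= h ->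
  Ck 2 U f ->
  (forall s t, s \in `[0, h] -> t \in `[0, h] -> U (t *: w + (s *: v + x))) ->
  exists xi eta, [/\ xi \in `[0, h], eta \in `[0, h] &
    f (h *: w + (h *: v + x)) - f (h *: v + x) - (f (h *: w + x) - f x)
    = 'D_w ('D_v f) (eta *: w + (xi *: v + x)) * h * h].
Proof.
move=> h0 [df /(_ v) [dvf _]] HU.
have I0 : 0 \in `[0, h] by rewrite in_itv /= lexx.
have Ih : h \in `[0, h] by rewrite in_itv /= lexx andbT.
have HU0 s : s \in `[0, h] -> U (s *: v + x).
  by move=> sI; have := HU s 0 sI I0; rewrite scale0r add0r.
have d1 s : s \in `[0, h] -> differentiable (fun y => f (h *: w + y)) (s *: v + x).
  by move=> sI; apply: differentiable_shiftl; apply: df; exact: HU.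
have d2 s : s \in `[0, h] -> differentiable f (s *: v + x).
  by move=> sI; apply: df; exact: HU0.
have [|xi xiI exi] := @MVT_line (fun y => f (h *: w + y) - f y) x v h h0.
  move=> s sI; apply: (@differentiableB _ _ _ (fun y => f (h *: w + y)) f).
    exact: d1.
  exact: d2.
have [|eta etaI eeta] := @MVT_line ('D_v f) (xi *: v + x) w h h0.
  by move=> t tI; apply: dvf; exact: HU.
exists xi, eta; split => //.
rewrite exi (@deriveB _ _ _ (fun y => f (h *: w + y)) f); last 2 first.
- exact/diff_derivable/d1.
- exact/diff_derivable/d2.
by rewrite derive_shiftl eeta.
Qed.

Lemma dist_half (a b c e : R) : `|a - c| < e / 2 -> `|b - c| < e / 2 -> `|a - b| <= e.
Proof.
move=> ac bc; rewrite -(subrK c a) -addrA (le_trans (ler_normD _ _)) //.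
by rewrite (splitr e) lerD ?(ltW ac) // distrC ltW.
Qed.

(** The second difference is symmetric in [v] and [w], so the two mixed derivatives take a common
    value at two points near [x]; by continuity this value is within [e / 2] of either mixed
    derivative at [x]. *)
Lemma derive_comm (f : E -> R^o) (U : set E) (x v w : E) :
  open U -> U x -> Ck 2 U f -> 'D_v ('D_w f) x = 'D_w ('D_v f) x.
Proof.
move=> oU Ux Cf; apply/eqP; rewrite -subr_eq0 -normr_le0.
apply/ler_addgt0Pl => e e0; rewrite addr0.
have cont (a b : E) : {for x, continuous ('D_a ('D_b f))}.
  by case: Cf => _ /(_ b) [_ /(_ a)]; apply.
have e20 : 0 < e / 2 by rewrite divr_gt0.
have near1 (a b : E) : \forall y \near x, `|'D_a ('D_b f) x - 'D_a ('D_b f) y| < e / 2.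
  by have /cvgrPdist_lt := cont a b; apply.
have nU : \forall y \near x, U y by exact: open_nbhs_nbhs.
have /nbhs_ballP [d /= d0 Hd] : \forall y \near x,
    [/\ U y, `|'D_v ('D_w f) x - 'D_v ('D_w f) y| < e / 2 &
        `|'D_w ('D_v f) x - 'D_w ('D_v f) y| < e / 2].
  by apply: filterS (filterI nU (filterI (near1 v w) (near1 w v))) => y [? []].
(* The summand 1 keeps [c] positive when [v] and [w] vanish; the step [h = d / (2 * c)] keeps the
   whole parallelogram inside the ball of radius [d]. *)
pose c := `|v| + `|w| + 1.
have c0 : 0 < c by rewrite ltr_wpDl // addr_ge0.
pose h := d / (2 * c).
have h0 : 0 < h by rewrite divr_gt0 // mulr_gt0.
have inb (a b : E) s t : `|a| + `|b| <= c -> s \in `[0, h] -> t \in `[0, h] ->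
    ball x d (t *: b + (s *: a + x)).
  move=> abc /[!in_itv] /= /andP[s0 sh] /andP[t0 th].
  rewrite -ball_normE /ball_ /= addrA opprD addrCA subrr addr0 normrN.
  apply: (le_lt_trans (ler_normD _ _)); rewrite !normrZ !ger0_norm //.
  apply: (@le_lt_trans _ _ (h * c)).
    apply: (@le_trans _ _ (h * (`|a| + `|b|))); last by rewrite ler_pM2l.
    by rewrite mulrDr addrC lerD // ler_wpM2r.
  by rewrite /h invfM mulrA divfK ?gt_eqF // ltr_pdivrMr // ltr_pMr // ltr1n.
have cvw : `|v| + `|w| <= c by rewrite lerDl.
have cwv : `|w| + `|v| <= c by rewrite addrC.
have [|x1 [y1 [x1I y1I E1]]] := @second_difference f U x v w h (ltW h0) Cf.
  by move=> s t sI tI; case: (Hd _ (inb v w s t cvw sI tI)).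
have [|x2 [y2 [x2I y2I E2]]] := @second_difference f U x w v h (ltW h0) Cf.
  by move=> s t sI tI; case: (Hd _ (inb w v s t cwv sI tI)).
have E12 : 'D_w ('D_v f) (y1 *: w + (x1 *: v + x)) =
           'D_v ('D_w f) (y2 *: v + (x2 *: w + x)).
  have hn0 : h != 0 by rewrite gt_eqF.
  move: E1 E2; rewrite [h *: v + (_ + _)]addrCA.
  move: ('D_w _ _ : R) ('D_v _ _ : R) (f _ : R) (f _ : R) (f _ : R) (f x : R).
  move=> X Y a b d1 d2 E1 E2.
  have E3 : X * h * h = Y * h * h by rewrite -E1 -E2; ring.
  exact: (mulIf hn0 (mulIf hn0 E3)).
have [_ _ B1] := Hd _ (inb _ _ _ _ cvw x1I y1I).
have [_ B2 _] := Hd _ (inb _ _ _ _ cwv x2I y2I).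
rewrite E12 in B1; exact: (dist_half B2 B1).
Qed.

End Schwarz.

(** * Smooth functions and tangent vectors on manifolds *)

Section Charts.
Context {R : realType}.

Lemma atlas_open_dom (T : topologicalType) (A : smoothStructure R T) c :
  atlas A c -> open (dom c).
Proof. by case/atlas_chart => [[]]. Qed.

Lemma atlas_open_cod (T : topologicalType) (A : smoothStructure R T) c :
  atlas A c -> open (cod c).
Proof. by case/atlas_chart => [[]]. Qed.

Lemma atlas_cmapK (T : topologicalType) (A : smoothStructure R T) c x :
  atlas A c -> dom c x -> cod c (cmap c x) /\ cinv c (cmap c x) = x.
Proof. by case/atlas_chart => _ H _ _ _; exact: H. Qed.

(** Product charts do not belong to a [smoothStructure]. This is the part of being a chart that
    smoothness of a composite uses, and it passes to products. *)
Definition cinv_continuous (T : topologicalType) (E : normedModType R) (c : chart T E) :=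
  open (cod c) /\ {in cod c, continuous (cinv c)}.

Lemma atlas_cinv_continuous (T : topologicalType) (A : smoothStructure R T) c :
  atlas A c -> cinv_continuous c.
Proof.
move=> Ac; split; first exact: atlas_open_cod Ac.
have := atlas_open_cod Ac; case/atlas_chart: Ac => _ _ _ _ + oc.
by rewrite continuous_open_subspace.
Qed.

Lemma prod_cinv_continuous (T T' : topologicalType) (E E' : normedModType R)
    (c : chart T E) (c' : chart T' E') :
  cinv_continuous c -> cinv_continuous c' -> cinv_continuous (prod_chart c c').
Proof.
move=> [oc cc] [oc' cc']; split.
  rewrite openE => -[u w] [/= cu cw].
  by exists (cod c, cod c') => //=; split; exact: open_nbhs_nbhs.
move=> [u w] /[!inE] -[/= cu cw].
have hu := cc u (mem_set cu); have hw := cc' w (mem_set cw).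
suff: (fun p => (cinv c p.1, cinv c' p.2)) @ (u, w) --> (cinv c u, cinv c' w) by [].
apply: cvg_pair => /=.
  exact: (cvg_comp fst (cinv c) (@cvg_fst _ _ (nbhs u) (nbhs w) _) hu).
exact: (cvg_comp snd (cinv c') (@cvg_snd _ _ (nbhs u) (nbhs w) _) hw).
Qed.

Lemma cinv_open (T : topologicalType) (E : normedModType R) (c : chart T E) (U : set T) :
  cinv_continuous c -> open U -> open [set u | cod c u /\ U (cinv c u)].
Proof. by move=> [oc cc] oU; exact: ((continuous_inP _ oc).1 cc). Qed.

(** Smoothness is local: near [u] the function factors through a chart [d] around [F (cinv c u)], as
    a transition map followed by the local expression of [h]. *)
Lemma cinfty_comp_chart (T T' : topologicalType) (E : normedModType R) (c : chart T E)
    (B : smoothStructure R T') (F : T -> T') (h : T' -> R) :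
  cinv_continuous c -> continuous F -> (forall d, atlas B d -> transition F c d) ->
  cinfty B h -> smooth_on (cod c) (fun u => h (F (cinv c u)) : R^o).
Proof.
move=> cc cF tF hB k; apply: Ck_cover => u cu.
have [d Bd dFu] := atlas_cover B (F (cinv c u)).
exists [set u | cod c u /\ dom d (F (cinv c u))] => //.
have oV : open [set u | cod c u /\ dom d (F (cinv c u))].
  apply: (cinv_open (U := F @^-1` dom d)) => //.
  by apply: open_comp; [move=> x _; exact: cF|exact: atlas_open_dom Bd].
apply: (Ck_ext oV); last first.
  apply: (Ck_comp_row (V := cod d) oV _ (tF d Bd k) (hB d Bd k)).
  by move=> x [_ /(atlas_cmapK Bd) []].
by move=> x [_ /(atlas_cmapK Bd) [_ /= ->]].
Qed.

Lemma cinfty_comp (T S : topologicalType) (A : smoothStructure R T)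
    (B : smoothStructure R S) (F : T -> S) (h : S -> R) :
  smooth_map (atlas A) (atlas B) F -> cinfty B h -> cinfty A (fun x => h (F x)).
Proof.
move=> [cF tF] hB c Ac.
exact: cinfty_comp_chart (atlas_cinv_continuous Ac) cF (fun d Bd => tF c d Ac Bd) hB.
Qed.

Lemma differentiable_pairl (E E' : normedModType R) (w : E') (u : E) :
  differentiable (fun u : E => (u, w)) u.
Proof. by apply: differentiable_pair => //; exact: differentiable_cst. Qed.

Lemma differentiable_pairr (E E' : normedModType R) (u : E) (w : E') :
  differentiable (fun w : E' => (u, w)) w.
Proof. by apply: differentiable_pair => //; exact: differentiable_cst. Qed.

Lemma pairl_affine (E E' : normedModType R) (w : E') (h : R) (v u : E) :
  (h *: v + u, w) = h *: (v, 0) + (u, w) :> E * E'.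
Proof. by congr pair; rewrite /= scaler0 add0r. Qed.

Lemma pairr_affine (E E' : normedModType R) (u : E) (h : R) (v w : E') :
  (u, h *: v + w) = h *: (0, v) + (u, w) :> E * E'.
Proof. by congr pair; rewrite /= scaler0 add0r. Qed.

End Charts.

(** * Smooth maps of two variables and push-forward of tangent vectors *)

Section SmoothMaps.
Context {R : realType}.
Variables (T T' S : topologicalType).
Variables (A : smoothStructure R T) (A' : smoothStructure R T') (B : smoothStructure R S).

Section TwoVariables.
Variable F : T * T' -> S.
Hypothesis sF : smooth_map (prod_atlas (atlas A) (atlas A')) (atlas B) F.

Lemma cinfty2_chart (h : S -> R) c c' : cinfty B h -> atlas A c -> atlas A' c' ->
  smooth_on (cod c `*` cod c') (fun p => h (F (cinv c p.1, cinv c' p.2)) : R^o).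
Proof.
move=> hB Ac A'c'; case: sF => cF tF.
have cc : cinv_continuous (prod_chart c c').
  by apply: prod_cinv_continuous; exact: atlas_cinv_continuous.
apply: (cinfty_comp_chart cc cF _ hB) => d Bd.
by apply: tF => //; exists c, c'.
Qed.

Lemma smooth_map_section1 y : smooth_map (atlas A) (atlas B) (fun x => F (x, y)).
Proof.
case: sF => cF tF; split.
  move=> x; apply: (@continuous_comp _ _ _ (fun x => (x, y)) F); last exact: cF.
  by apply: cvg_pair; [exact: cvg_id|exact: cvg_cst].
move=> c d Ac Bd k; have [c' A'c' c'y] := atlas_cover A' y.
have [cw ew] := atlas_cmapK A'c' c'y.
have := tF (prod_chart c c') d _ Bd k; have P : prod_atlas (atlas A) (atlas A') (prod_chart c c').
  by exists c, c'.
move=> /(_ P) H.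
have := @Ck_affine R _ _ _ k [set u | cod c u /\ dom d (F (cinv c u, y))] _ _
  (fun u => (u, cmap c' y)) (fun u => (u, 0)) (pairl_affine _)
  (differentiable_pairl _) _ H.
rewrite /comp /= ew; apply.
by move=> u [cu du]; split => //=; rewrite ew.
Qed.

Lemma smooth_map_section2 x : smooth_map (atlas A') (atlas B) (fun y => F (x, y)).
Proof.
case: sF => cF tF; split.
  move=> y; apply: (@continuous_comp _ _ _ (fun y => (x, y)) F); last exact: cF.
  by apply: cvg_pair; [exact: cvg_cst|exact: cvg_id].
move=> c' d A'c' Bd k; have [c Ac cx] := atlas_cover A x.
have [cw ew] := atlas_cmapK Ac cx.
have := tF (prod_chart c c') d _ Bd k; have P : prod_atlas (atlas A) (atlas A') (prod_chart c c').
  by exists c, c'.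
move=> /(_ P) H.
have := @Ck_affine R _ _ _ k [set u | cod c' u /\ dom d (F (x, cinv c' u))] _ _
  (fun u => (cmap c x, u)) (fun u => (0, u)) (pairr_affine _)
  (differentiable_pairr _) _ H.
rewrite /comp /= ew; apply.
by move=> u [cu du]; split => //=; rewrite ew.
Qed.

(** A tangent vector in the first variable is the directional derivative along [(v, 0)] of the
    two-variable local expression. One order of differentiability is spent on it, hence the index
    [k.+1] below. *)
Lemma cinfty_tangent1 p (D : (T -> R) -> R) (h : S -> R) :
  tangent A p D -> cinfty B h -> cinfty A' (fun y => D (fun x => h (F (x, y)))).
Proof.
move=> [c [v [Ac cp eD]]] hB c' A'c' k.
have oc' := atlas_open_cod A'c'.
have Ch := cinfty2_chart hB Ac A'c'.
have [_ /(_ (v, 0)) CD] := Ch k.+1.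
have [ccp _] := atlas_cmapK Ac cp.
apply: (Ck_ext oc'); last first.
  apply: (Ck_affine (io := fun w => (cmap c p, w)) (l := fun w => (0, w))
    (pairr_affine _) (differentiable_pairr _) _ CD).
  by move=> u cu; split.
move=> w cw /=; rewrite eD; last exact: cinfty_comp (smooth_map_section1 _) hB.
apply/esym/(@derive_affine R _ _ _ (fun q => h (F (cinv c q.1, cinv c' q.2)) : R^o) (fun u => (u, w)) v (v, 0)).
by move=> r y; exact: pairl_affine.
Qed.

Lemma cinfty_tangent2 p (D : (T' -> R) -> R) (h : S -> R) :
  tangent A' p D -> cinfty B h -> cinfty A (fun x => D (fun y => h (F (x, y)))).
Proof.
move=> [c' [v [A'c' cp eD]]] hB c Ac k.
have oc := atlas_open_cod Ac.
have Ch := cinfty2_chart hB Ac A'c'.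
have [_ /(_ (0, v)) CD] := Ch k.+1.
have [ccp _] := atlas_cmapK A'c' cp.
apply: (Ck_ext oc); last first.
  apply: (Ck_affine (io := fun u => (u, cmap c' p)) (l := fun u => (u, 0))
    (pairl_affine _) (differentiable_pairl _) _ CD).
  by move=> u cu; split.
move=> w cw /=; rewrite eD; last exact: cinfty_comp (smooth_map_section2 _) hB.
apply/esym/(@derive_affine R _ _ _ (fun q => h (F (cinv c q.1, cinv c' q.2)) : R^o) (fun u => (w, u)) v (0, v)).
by move=> r y; exact: pairr_affine.
Qed.

(** This is [derive_comm] in the directions [(v, 0)] and [(0, w)]; it is the source of the
    commutation of left- and right-invariant fields. *)
Lemma tangent_comm p q (D : (T -> R) -> R) (D' : (T' -> R) -> R) (h : S -> R) :
  tangent A p D -> tangent A' q D' -> cinfty B h ->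
  D (fun x => D' (fun y => h (F (x, y)))) = D' (fun y => D (fun x => h (F (x, y)))).
Proof.
move=> tD tD' hB.
have C1 := cinfty_tangent2 tD' hB; have C2 := cinfty_tangent1 tD hB.
have S1 y := cinfty_comp (smooth_map_section1 y) hB.
have S2 x := cinfty_comp (smooth_map_section2 x) hB.
move: tD tD' => [c [v [Ac cp eD]]] [c' [w [A'c' cq eD']]].
have Ch := cinfty2_chart hB Ac A'c'.
have [ccp _] := atlas_cmapK Ac cp.
have [ccq _] := atlas_cmapK A'c' cq.
set G := (fun p : _ * _ => h (F (cinv c p.1, cinv c' p.2)) : R^o) in Ch.
have e1 x0 : (fun u => D' (fun y => h (F (cinv c u, y)))) x0 =
    ('D_(0, w) G \o (fun u => (u, cmap c' q))) x0.
  rewrite /= eD' //; apply: (@derive_affine R _ _ _ G (fun u => (x0, u)) w (0, w)).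
  by move=> r y; exact: pairr_affine.
have e2 y0 : (fun u => D (fun x => h (F (x, cinv c' u)))) y0 =
    ('D_(v, 0) G \o (fun u => (cmap c p, u))) y0.
  rewrite /= eD //; apply: (@derive_affine R _ _ _ G (fun u => (u, y0)) v (v, 0)).
  by move=> r y; exact: pairl_affine.
rewrite (eD _ C1) (eD' _ C2) (funext e1) (funext e2).
rewrite (derive_affine _ (w := (v, 0))); last by move=> k y; exact: pairl_affine.
rewrite (derive_affine _ (w := (0, w))); last by move=> k y; exact: pairr_affine.
apply: (@derive_comm _ _ _ (cod c `*` cod c')) => //.
by case: (prod_cinv_continuous (atlas_cinv_continuous Ac) (atlas_cinv_continuous A'c')).
Qed.

End TwoVariables.

(** In a chart [d] around [F p] the image vector is the velocity ['D_v phi] of the local expression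
    [phi] of [F], by the chain rule. *)
Lemma tangent_push (F : T -> S) p (D : (T -> R) -> R) :
  smooth_map (atlas A) (atlas B) F -> tangent A p D ->
  tangent B (F p) (fun h => D (fun x => h (F x))).
Proof.
move=> sF [c [v [Ac cp eD]]].
have [d Bd dF] := atlas_cover B (F p).
have [ccp ep] := atlas_cmapK Ac cp.
have [dFp eFp] := atlas_cmapK Bd dF.
pose phi u := cmap d (F (cinv c u)).
exists d, ('D_v phi (cmap c p)); split => // h hB.
rewrite eD; last exact: (cinfty_comp sF hB).
case: sF => cF tF; have [dphi _] := tF c d Ac Bd 1%N.
have [dh _] := hB d Bd 1%N.
have phip : phi (cmap c p) = cmap d (F p) by rewrite /phi ep.
have dphip : differentiable phi (cmap c p) by apply: dphi; split=> //; rewrite ep.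
have dhp : differentiable (fun u => h (cinv d u) : R^o) (phi (cmap c p)).
  by apply: dh; rewrite phip.
transitivity ('D_v ((fun u => h (cinv d u) : R^o) \o phi) (cmap c p)).
  apply: near_eq_derive; have oV : open [set u | cod c u /\ dom d (F (cinv c u))].
    apply: (cinv_open (U := F @^-1` dom d)); first exact: atlas_cinv_continuous Ac.
    by apply: open_comp; [move=> x _; exact: cF|exact: atlas_open_dom Bd].
  apply: (near_open_eq oV); last by split => //; rewrite ep.
  by move=> x [_ /(atlas_cmapK Bd) [_ /= ->]].
rewrite deriveE; last exact: differentiable_comp.
by rewrite diff_comp //= -(deriveE v dphip) -(deriveE _ dhp) phip.
Qed.

End SmoothMaps.

(** * The algebra of smooth functions, local quotients and derivations *)

Section Cinfty.
Context {R : realType} {T : topologicalType} {A : smoothStructure R T}.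
Implicit Types f h : T -> R.

Lemma cinfty_cst (a : R) : cinfty A (fun=> a).
Proof. by move=> c Ac k; exact: Ck_cst. Qed.

Lemma cinftyD f h : cinfty A f -> cinfty A h -> cinfty A (fun x => f x + h x).
Proof.
move=> Cf Ch c Ac k; have oc := atlas_open_cod Ac.
exact: (CkD oc (Cf c Ac k) (Ch c Ac k)).
Qed.

Lemma cinftyM f h : cinfty A f -> cinfty A h -> cinfty A (fun x => f x * h x).
Proof.
move=> Cf Ch c Ac k; have oc := atlas_open_cod Ac.
exact: (CkM oc (Cf c Ac k) (Ch c Ac k)).
Qed.

Lemma cinftyZ (a : R) f : cinfty A f -> cinfty A (fun x => a * f x).
Proof. by move=> Cf; apply: cinftyM => //; exact: cinfty_cst. Qed.

Lemma cinftyN f : cinfty A f -> cinfty A (fun x => - f x).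
Proof. by move=> /(cinftyZ (-1)); under eq_fun do rewrite mulN1r. Qed.

Lemma cinftyB f h : cinfty A f -> cinfty A h -> cinfty A (fun x => f x - h x).
Proof. by move=> Cf Ch; apply: cinftyD => //; exact: cinftyN. Qed.

Lemma cinfty_sum (I : Type) (r : seq I) (P : pred I) (F : I -> T -> R) :
  (forall i, cinfty A (F i)) -> cinfty A (fun x => \sum_(i <- r | P i) F i x).
Proof.
move=> H; elim: r => [|i r IH].
  by under eq_fun do rewrite big_nil; exact: cinfty_cst.
under eq_fun do rewrite big_cons; case: (P i) => //.
exact: (cinftyD (H i) IH).
Qed.

Lemma cinfty_prod (I : Type) (r : seq I) (P : pred I) (F : I -> T -> R) :
  (forall i, cinfty A (F i)) -> cinfty A (fun x => \prod_(i <- r | P i) F i x).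
Proof.
move=> H; elim: r => [|i r IH].
  by under eq_fun do rewrite big_nil; exact: cinfty_cst.
under eq_fun do rewrite big_cons; case: (P i) => //.
exact: (cinftyM (H i) IH).
Qed.

Lemma cinfty_det n (X : T -> 'M[R]_n) :
  (forall i j, cinfty A (fun x => X x i j)) -> cinfty A (fun x => \det (X x)).
Proof.
move=> CX; rewrite /determinant.
apply: (cinfty_sum _ _ (F := fun (s : {perm _}) x => (-1) ^+ s * \prod_i X x i (s i))) => s.
apply: (cinftyZ ((-1) ^+ s) (f := fun x => \prod_i X x i (s i))).
exact: (cinfty_prod _ _ (F := fun i x => X x i (s i))).
Qed.

(** Numerator and denominator are global functions that may change with [x0]; the quotient formula
    is used only on the open set where the denominator is nonzero. *)
Lemma cinfty_div f :
  (forall x0, exists u w, [/\ cinfty A u, cinfty A w, w x0 != 0 &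
     forall x, f x * w x = u x]) -> cinfty A f.
Proof.
move=> H c Ac k; apply: Ck_cover => u cu.
have [a [b [Ca Cb b0 E]]] := H (cinv c u).
have oc := atlas_open_cod Ac.
pose V := [set u | cod c u /\ b (cinv c u) != 0].
have oV : open V.
  have cb : {in cod c, continuous (fun u => b (cinv c u))}.
    by move=> x; rewrite inE => cx; exact: (Cb c Ac 0%N).
  have := (continuous_inP _ oc).1 cb [set r | r != 0]; apply.
  exact: open_neq.
exists V => //.
have VU : V `<=` cod c by move=> x [].
have V0 x : V x -> b (cinv c x) != 0 by case.
have Cb' := CkV oV V0 (Ck_sub VU (Cb c Ac k)).
apply: (Ck_ext oV) (CkM oV (Ck_sub VU (Ca c Ac k)) Cb').
by move=> x Vx /=; rewrite -E mulfK //; exact: V0.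
Qed.

(* Cramer's rule: a solution of a smooth, locally invertible linear system is smooth. *)
Lemma cinfty_solve n (v : T -> 'rV[R]_n) :
  (forall x0, exists (X : T -> 'M[R]_n), [/\
     forall i j, cinfty A (fun x => X x i j),
     forall j, cinfty A (fun x => (v x *m X x) 0 j) & \det (X x0) != 0]) ->
  forall i, cinfty A (fun x => v x 0 i).
Proof.
move=> H i; apply: cinfty_div => x0; have [X [CX CvX dX]] := H x0.
exists (fun x => \sum_j (v x *m X x) 0 j * \adj (X x) j i), (fun x => \det (X x)).
split => //.
- apply: (cinfty_sum _ _ (F := fun j x => (v x *m X x) 0 j * \adj (X x) j i)) => j.
  apply: (cinftyM (f := fun x => (v x *m X x) 0 j) (h := fun x => \adj (X x) j i)) => //.
  under eq_fun do rewrite mxE.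
  apply: (cinftyZ _ (f := fun x => \det (row' i (col' j (X x))))).
  apply: cinfty_det => a b.
  by under eq_fun do rewrite !mxE; exact: CX.
- exact: cinfty_det.
- move=> x; have -> : \sum_j (v x *m X x) 0 j * \adj (X x) j i =
      (v x *m X x *m \adj (X x)) 0 i by rewrite [RHS]mxE.
  by rewrite -mulmxA mul_mx_adj mul_mx_scalar mxE mulrC.
Qed.

(** Common ground for tangent vectors and for the bracket with a fixed function at a point, which is
    given by its algebraic rules and not by a chart. *)
Definition derivation (p : T) (D : (T -> R) -> R) :=
  (forall a f h, cinfty A f -> cinfty A h -> D (fun x => a * f x + h x) = a * D f + D h) /\
  (forall f h, cinfty A f -> cinfty A h -> D (fun x => f x * h x) = f p * D h + h p * D f).

Lemma tangent_derivation p D : tangent A p D -> derivation p D.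
Proof.
move=> [c [v [Ac cp eD]]]; have [ccp ep] := atlas_cmapK Ac cp.
split=> [a f h|f h] Cf Ch; have [df _] := Cf c Ac 1%N; have [dh _] := Ch c Ac 1%N;
  pose f1 u := f (cinv c u) : R^o; pose h1 u := h (cinv c u) : R^o.
- rewrite !eD //; last exact: cinftyD (cinftyZ a Cf) Ch.
  rewrite (@deriveD _ _ _ (a \*: f1) h1).
  + by rewrite deriveZ //; exact/diff_derivable/df.
  + exact/derivableZ/diff_derivable/df.
  + exact/diff_derivable/dh.
- rewrite !eD //; last exact: cinftyM Cf Ch.
  rewrite (@deriveM _ _ f1 h1); [|exact/diff_derivable/df|exact/diff_derivable/dh].
  by rewrite /f1 /h1 ep.
Qed.

Lemma pb_derivation (P : poisson A) f p : cinfty A f -> derivation p (fun h => P h f p).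
Proof.
move=> Cf; split=> [a h1 h2|h1 h2] C1 C2; first exact: pb_linear.
by rewrite pb_leibniz // [X in _ + X]mulrC.
Qed.

Section Derivation.
Context {p : T} {D : (T -> R) -> R}.
Hypothesis dD : derivation p D.

Lemma derivation_cst (a : R) : D (fun=> a) = 0.
Proof.
have C1 := cinfty_cst 1; have C0 := cinfty_cst 0; case: dD => lD mD.
have D1 : D (fun=> 1) = 0.
  have := mD _ _ C1 C1; under eq_fun do rewrite mul1r.
  by rewrite !mul1r => /eqP; rewrite -subr_eq0 opprD addrA subrr sub0r oppr_eq0 => /eqP.
have D0 : D (fun=> 0) = 0.
  have := mD _ _ C1 C0; under eq_fun do rewrite mul1r.
  by rewrite D1 mulr0 addr0 mul1r => _; have := lD (-1) _ _ C1 C1;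
     under eq_fun do rewrite mulN1r addNr; rewrite D1 mulr0 addr0.
have := lD a _ _ C1 C0; under eq_fun do rewrite mulr1 addr0.
by rewrite D1 D0 mulr0 addr0.
Qed.

Lemma derivationD f h : cinfty A f -> cinfty A h ->
  D (fun x => f x + h x) = D f + D h.
Proof.
move=> Cf Ch; case: dD => lD _; rewrite -[D f]mul1r -lD //.
by under [in RHS]eq_fun do rewrite mul1r.
Qed.

Lemma derivationM f h : cinfty A f -> cinfty A h ->
  D (fun x => f x * h x) = f p * D h + h p * D f.
Proof. by case: dD => _; apply. Qed.

Lemma derivationZ (a : R) f : cinfty A f -> D (fun x => a * f x) = a * D f.
Proof.
move=> Cf; case: dD => lD _; have := lD a _ _ Cf (cinfty_cst 0).
by rewrite derivation_cst addr0 => <-; congr D; apply/funext => x; rewrite addr0.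
Qed.

Lemma derivationN f : cinfty A f -> D (fun x => - f x) = - D f.
Proof.
by move=> Cf; rewrite -mulN1r -derivationZ //; congr D; apply/funext => x; rewrite mulN1r.
Qed.

Lemma derivation_sum (I : Type) (r : seq I) (P : pred I) (F : I -> T -> R) :
  (forall i, cinfty A (F i)) ->
  D (fun x => \sum_(i <- r | P i) F i x) = \sum_(i <- r | P i) D (F i).
Proof.
move=> CF; elim: r => [|i r IH].
  by under eq_fun do rewrite big_nil; rewrite big_nil derivation_cst.
rewrite big_cons; under eq_fun do rewrite big_cons; case: (P i) => //.
by rewrite (derivationD (CF i) (cinfty_sum r P CF)) IH.
Qed.

End Derivation.
End Cinfty.

(** * Complex-valued functions and the complex-linear extension of derivations *)

Section ComplexFunctions.
Context {R : realType} {T : topologicalType} {A : smoothStructure R T}.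
Implicit Types f h : T -> R[i].

Definition cinftyC f :=
  cinfty A (fun x => complex.Re (f x)) /\ cinfty A (fun x => complex.Im (f x)).

Definition derC (D : (T -> R) -> R) f : R[i] :=
  Complex (D (fun x => complex.Re (f x))) (D (fun x => complex.Im (f x))).

Lemma complexReD (a b : R[i]) : complex.Re (a + b) = complex.Re a + complex.Re b.
Proof. by case: a; case: b. Qed.

Lemma complexImD (a b : R[i]) : complex.Im (a + b) = complex.Im a + complex.Im b.
Proof. by case: a; case: b. Qed.

Lemma complexReM (a b : R[i]) : complex.Re (a * b) =
  complex.Re a * complex.Re b - complex.Im a * complex.Im b.
Proof. by case: a; case: b. Qed.

Lemma complexImM (a b : R[i]) : complex.Im (a * b) =
  complex.Re a * complex.Im b + complex.Im a * complex.Re b.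
Proof. by case: a; case: b. Qed.


Lemma cinftyC_cst (a : R[i]) : cinftyC (fun=> a).
Proof. by split; exact: cinfty_cst. Qed.

Lemma cinftyC_real (f : T -> R) : cinfty A f -> cinftyC (fun x => real_complex R (f x)).
Proof. by move=> Cf; split=> //=; exact: cinfty_cst. Qed.

Lemma cinftyCD f h : cinftyC f -> cinftyC h -> cinftyC (fun x => f x + h x).
Proof.
move=> [f1 f2] [h1 h2]; split.
  by under eq_fun do rewrite complexReD; exact: cinftyD f1 h1.
by under eq_fun do rewrite complexImD; exact: cinftyD f2 h2.
Qed.

Lemma cinftyCM f h : cinftyC f -> cinftyC h -> cinftyC (fun x => f x * h x).
Proof.
move=> [f1 f2] [h1 h2]; split.
  by under eq_fun do rewrite complexReM; exact: cinftyB (cinftyM f1 h1) (cinftyM f2 h2).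
by under eq_fun do rewrite complexImM; exact: cinftyD (cinftyM f1 h2) (cinftyM f2 h1).
Qed.

Lemma cinftyC_sum (I : Type) (r : seq I) (P : pred I) (F : I -> T -> R[i]) :
  (forall i, cinftyC (F i)) -> cinftyC (fun x => \sum_(i <- r | P i) F i x).
Proof.
move=> H; elim: r => [|i r IH].
  by under eq_fun do rewrite big_nil; exact: cinftyC_cst.
under eq_fun do rewrite big_cons; case: (P i) => //.
exact: cinftyCD (H i) IH.
Qed.

Section DerC.
Context {p : T} {D : (T -> R) -> R}.
Hypothesis dD : derivation (A := A) p D.

Lemma derC_real (f : T -> R) : derC D (fun x => real_complex R (f x)) = real_complex R (D f).
Proof. by rewrite /derC /= (derivation_cst dD). Qed.

Lemma derC_cst (a : R[i]) : derC D (fun=> a) = 0.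
Proof. by rewrite /derC !(derivation_cst dD). Qed.

Lemma derCD f h : cinftyC f -> cinftyC h -> derC D (fun x => f x + h x) = derC D f + derC D h.
Proof.
move=> [f1 f2] [h1 h2]; rewrite /derC.
under eq_fun do rewrite complexReD; under [X in Complex _ (D X)]eq_fun do rewrite complexImD.
by rewrite !(derivationD dD).
Qed.

Lemma derCM f h : cinftyC f -> cinftyC h ->
  derC D (fun x => f x * h x) = f p * derC D h + h p * derC D f.
Proof.
move=> [f1 f2] [h1 h2]; rewrite /derC.
under eq_fun do rewrite complexReM; under [X in Complex _ (D X)]eq_fun do rewrite complexImM.
rewrite (derivationD dD (cinftyM f1 h1) (cinftyN (cinftyM f2 h2))).
rewrite (derivationN dD (cinftyM f2 h2)).
rewrite (derivationD dD (cinftyM f1 h2) (cinftyM f2 h1)) !(derivationM dD) //.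
by case: (f p) => a b; case: (h p) => c d /=; congr Complex; rewrite /=; ring.
Qed.

Lemma derCZ (a : R[i]) f : cinftyC f -> derC D (fun x => a * f x) = a * derC D f.
Proof.
by move=> Cf; rewrite (derCM (cinftyC_cst a) Cf) derC_cst mulr0 addr0.
Qed.

Lemma derC_sum (I : Type) (r : seq I) (P : pred I) (F : I -> T -> R[i]) :
  (forall i, cinftyC (F i)) ->
  derC D (fun x => \sum_(i <- r | P i) F i x) = \sum_(i <- r | P i) derC D (F i).
Proof.
move=> CF; elim: r => [|i r IH].
  by under eq_fun do rewrite big_nil; rewrite big_nil derC_cst.
rewrite big_cons; under eq_fun do rewrite big_cons; case: (P i) => //.
by rewrite (derCD (CF i) (cinftyC_sum r P CF)) IH.
Qed.

End DerC.
End ComplexFunctions.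
Arguments derivation {R T} A p D.
Arguments cinftyC {R T} A f.

(** * Invariant vector fields and the adjoint action on a Lie group *)

Section LieGroupTheory.
Context {R : realType}.
Variables (K : topGroupType) (AK : smoothStructure R K) (k : vectType R).
Variables (brk : k -> k -> k) (lam : k -> (K -> R) -> R).
Hypothesis hK : lie_group AK.
Hypothesis hlam : lie_algebra_of AK brk lam.
Implicit Types (X Y Z : k) (a h : K -> R) (y : K).

Let e (i : 'I_(\dim {:k})) : k := (vbasis {:k})`_i.
Let co i : k -> R := coord (vbasis {:k}) i.

Lemma vbasis_expand X : X = \sum_i co i X *: e i.
Proof. by rewrite {1}(coord_vbasis (memvf X)). Qed.

Lemma coord_vbasis_delta i j : co j (e i) = (i == j)%:R :> R.
Proof. by rewrite /co /e coord_free ?(basis_free (vbasisP _)) // eq_sym. Qed.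

Lemma lam_tangent X : tangent AK 1%g (lam X).
Proof. by case: hlam => + _ _ _ _; exact. Qed.

Lemma lam_inj X Y : (forall h, cinfty AK h -> lam X h = lam Y h) -> X = Y.
Proof. by case: hlam => _ _ + _ _; exact. Qed.

Lemma lam_linear (r : R) X Y h : cinfty AK h ->
  lam (r *: X + Y) h = r * lam X h + lam Y h.
Proof. by case: hlam => _ _ _ + _; exact. Qed.

Lemma lam_derivation X : derivation AK 1%g (lam X).
Proof. exact/tangent_derivation/lam_tangent. Qed.

Lemma lam0 h : cinfty AK h -> lam 0 h = 0.
Proof.
move=> Ch; have := lam_linear 1 0 0 Ch; rewrite scaler0 addr0 mul1r.
by move/eqP; rewrite -subr_eq0 opprD addrA subrr sub0r oppr_eq0 => /eqP.
Qed.

Lemma lam_sum (I : Type) (r : seq I) (c : I -> R) (F : I -> k) h : cinfty AK h ->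
  lam (\sum_(i <- r) c i *: F i) h = \sum_(i <- r) c i * lam (F i) h.
Proof.
move=> Ch; elim: r => [|i r IH]; first by rewrite !big_nil lam0.
by rewrite !big_cons lam_linear // IH.
Qed.

Lemma lam_expand X h : cinfty AK h -> lam X h = \sum_i co i X * lam (e i) h.
Proof. by move=> Ch; rewrite {1}(vbasis_expand X) lam_sum. Qed.

(* A rank argument: the differentials at 1 of smooth functions separate k, hence span its dual. *)
Lemma lam_dual (xi : {linear k -> R^o}) :
  exists2 h, cinfty AK h & forall X, lam X h = xi X.
Proof.
pose d := \dim {:k}.
pose ro h : 'rV[R]_d := \row_i lam (e i) h.
pose P n := exists m (B : 'M[R]_(m, d)), \rank B = n /\
  forall i, exists2 h, cinfty AK h & row i B = ro h.
have P0 : exists n, `[< P n >].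
  by exists 0%N; apply/asboolP; exists 0%N, 0; split; [rewrite mxrank0|case].
have Pd n : `[< P n >] -> (n <= d)%N.
  by move=> /asboolP [m [B [<- _]]]; exact: rank_leq_col.
have [n /asboolP [m [B [rB HB]]] max_n] := ex_maxnP P0 Pd.
(* Appending a differential outside the row space of [B] would raise the rank above its maximum. *)
have fB h : cinfty AK h -> (ro h <= B)%MS.
  move=> Ch; apply: contraT => nB.
  have lt : (B < col_mx B (ro h))%MS.
    rewrite ltmxE -!addsmxE addsmxSl /=.
    by apply: contra nB => H; apply: submx_trans H; exact: addsmxSr.
  have rk := rank_ltmx lt.
  have /max_n : `[< P (\rank (col_mx B (ro h))) >].
    apply/asboolP; exists (m + 1)%N, (col_mx B (ro h)); split => // i.
    case: (split_ordP i) => j ->.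
      by rewrite rowKu; exact: HB.
    by rewrite rowKd; exists h => //; apply/rowP => l; rewrite !mxE.
  by rewrite leqNgt -rB rk.
(* A column of the cokernel of [B] is a vector [X] killed by all differentials, hence zero by
   [lam_inj]. *)
have full : row_full B.
  rewrite -cokermx_eq0; apply/eqP/matrixP => i j; rewrite [RHS]mxE.
  pose X := \sum_l (cokermx B) l j *: e l.
  have X0 : X = 0.
    apply: lam_inj => h Ch; rewrite lam0 // lam_sum //.
    have /submxP [D eD] := fB h Ch.
    have : (ro h *m cokermx B) 0 j = 0 by rewrite eD -mulmxA mulmx_coker mulmx0 mxE.
    rewrite mxE => E; rewrite -[RHS]E; apply: eq_bigr => l _.
    by rewrite [ro h _ _]mxE mulrC.
  have := congr1 (co i) X0; rewrite /co linear0 /X linear_sum (bigD1 i) //= big1 ?addr0.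
    by rewrite linearZ /= -/(co i (e i)) coord_vbasis_delta eqxx mulr1.
  move=> l li; rewrite linearZ /= -/(co i (e l)) coord_vbasis_delta (negbTE li).
  by rewrite mulr0.
have /submxP [D eD] : ((\row_i xi (e i)) <= B)%MS by exact: submx_full.
have HB' i : exists h, cinfty AK h /\ row i B = ro h by have [h] := HB i; exists h.
have [hs Hhs] := choice HB'.
exists (fun y => \sum_i D 0 i * hs i y).
  by apply: (cinfty_sum _ _ (F := fun i y => D 0 i * hs i y)) => i; exact/cinftyZ/(Hhs i).1.
move=> X; rewrite (derivation_sum (lam_derivation X)); last first.
  by move=> i; exact/cinftyZ/(Hhs i).1.
under eq_bigr => i _.
  rewrite (derivationZ (lam_derivation X)) ?lam_expand; last 2 first.
  - exact: (Hhs i).1.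
  - exact: (Hhs i).1.
  over.
rewrite {2}(vbasis_expand X) linear_sum.
under eq_bigr do rewrite mulr_sumr.
rewrite exchange_big /=; apply: eq_bigr => j _.
rewrite linearZ /=; have := congr1 (fun v : 'rV_d => v 0 j) eD; rewrite !mxE => ->.
rewrite /GRing.scale /= mulr_sumr; apply: eq_bigr => i _.
have := congr1 (fun v : 'rV_d => v 0 j) (Hhs i).2; rewrite !mxE => ->.
by rewrite mulrCA.
Qed.

Lemma lam_dual_basis : exists hs : 'I_(\dim {:k}) -> K -> R,
  (forall i, cinfty AK (hs i)) /\ forall i X, lam X (hs i) = co i X.
Proof.
have H i : exists h, cinfty AK h /\ forall X, lam X h = co i X.
  by have [h] := lam_dual (coord (vbasis {:k}) i); exists h.
by have [hs Hhs] := choice H; exists hs; split=> i; case: (Hhs i).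
Qed.

Lemma cinfty_mull h y : cinfty AK h -> cinfty AK (fun z => h (y * z)%g).
Proof. exact: cinfty_comp (smooth_map_section2 hK.1 y). Qed.

Lemma cinfty_mulr h y : cinfty AK h -> cinfty AK (fun z => h (z * y)%g).
Proof. exact: cinfty_comp (smooth_map_section1 hK.1 y). Qed.

(** [lfield X] is the left-invariant field with value [X] at 1, since it differentiates under
    multiplication on the right; [rfield X] is the right-invariant one. *)
Definition lfield X a y := lam X (fun z => a (y * z)%g).
Definition rfield X a y := lam X (fun z => a (z * y)%g).

Lemma cinfty_lfield X a : cinfty AK a -> cinfty AK (lfield X a).
Proof. exact: (cinfty_tangent2 hK.1 (lam_tangent X)). Qed.

Lemma cinfty_rfield X a : cinfty AK a -> cinfty AK (rfield X a).
Proof. exact: (cinfty_tangent1 hK.1 (lam_tangent X)). Qed.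

Lemma lfield_tangent X y : tangent AK y (fun a => lfield X a y).
Proof.
have := tangent_push (smooth_map_section2 hK.1 y) (lam_tangent X).
by rewrite /= mulg1.
Qed.

Lemma lfield_derivation X y : derivation AK y (fun a => lfield X a y).
Proof. exact/tangent_derivation/lfield_tangent. Qed.

Lemma rfield_expand X a y : cinfty AK a ->
  rfield X a y = \sum_i co i X * rfield (e i) a y.
Proof. by move=> Ca; rewrite /rfield lam_expand //; exact: cinfty_mulr. Qed.

Lemma lfield_bracket X Y a y : cinfty AK a ->
  lfield (brk X Y) a y = lfield X (lfield Y a) y - lfield Y (lfield X a) y.
Proof.
move=> Ca; case: hlam => _ _ _ _ H; rewrite /lfield H; last exact: cinfty_mull.
by congr (_ - _); congr lam; apply/funext => z; congr lam; apply/funext => w; rewrite mulgA.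
Qed.

Lemma lfield_rfield_comm X Z a y : cinfty AK a ->
  lfield Z (rfield X a) y = rfield X (lfield Z a) y.
Proof.
move=> Ca; have := tangent_comm hK.1 (lam_tangent X) (lfield_tangent Z y) Ca.
rewrite /= /lfield /rfield => <-.
by congr lam; apply/funext => w; congr lam; apply/funext => v; rewrite mulgA.
Qed.

Lemma inv_push X : exists W, forall h, cinfty AK h -> lam X (fun z => h z^-1%g) = lam W h.
Proof.
have := tangent_push hK.2 (lam_tangent X); rewrite invg1 => t.
by case: hlam => _ + _ _ _ => /(_ _ t).
Qed.

Lemma conj_push y X : exists W, forall h, cinfty AK h ->
  lam W h = lam X (fun z => h (y * z * y^-1)%g).
Proof.
have := tangent_push (smooth_map_section1 hK.1 y^-1%g) (lfield_tangent X y).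
rewrite /= mulgV => t.
case: hlam => _ + _ _ _ => /(_ _ t) [W HW]; exists W => h Ch.
by rewrite -HW.
Qed.

(** The push-forward of [lam X] under conjugation is a tangent vector at 1; the vector representing
    it is picked by choice and is unique by [lam_inj]. Its regularity in [y] therefore needs a
    separate argument. *)
Definition Ad y X : k := projT1 (cid (conj_push y X)).

Lemma lam_Ad y X h : cinfty AK h -> lam (Ad y X) h = lam X (fun z => h (y * z * y^-1)%g).
Proof. exact: (projT2 (cid (conj_push y X))). Qed.

Lemma Ad_linear y : linear (Ad y).
Proof.
move=> r X Y; apply: lam_inj => h Ch.
rewrite lam_linear // !lam_Ad // lam_linear //.
by apply: (cinfty_mull (h := fun z => h (z * y^-1)%g)); exact: cinfty_mulr.
Qed.

Lemma Ad_unique y X W : (forall h, cinfty AK h ->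
  lam X (fun z => h (y * z * y^-1)%g) = lam W h) -> Ad y X = W.
Proof. by move=> H; apply: lam_inj => h Ch; rewrite lam_Ad // H. Qed.

(** Since [y * z = (y * z * y^-1) * y], a left-invariant field is a right-invariant one with
    coefficients depending on the point. *)
Lemma lfield_Ad X a y : cinfty AK a -> lfield X a y = rfield (Ad y X) a y.
Proof.
move=> Ca; rewrite /rfield lam_Ad; last exact: cinfty_mulr.
by congr lam; apply/funext => z; rewrite mulgVK.
Qed.

Lemma lfield_rfield_Ad X a : cinfty AK a ->
  lfield X a = fun y => \sum_i co i (Ad y X) * rfield (e i) a y.
Proof. by move=> Ca; apply/funext => y; rewrite lfield_Ad // rfield_expand. Qed.

(** By [lfield_rfield_Ad] the coordinates solve a linear system whose coefficients
    [rfield (e i) (a j)] and right-hand sides [lfield X (a j)] are smooth. The [a j] are dual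
    coordinates translated to [y0], which makes the matrix the identity there. *)
Lemma cinfty_coord_Ad X i : cinfty AK (fun y => co i (Ad y X)).
Proof.
have [hs [Chs Ehs]] := lam_dual_basis.
suff : forall i, cinfty AK (fun y => (\row_j co j (Ad y X)) 0 i).
  by move=> /(_ i); under eq_fun do rewrite mxE.
apply: cinfty_solve => y0.
pose a j := fun z : K => hs j (z * y0^-1)%g.
have Ca j : cinfty AK (a j) by exact: cinfty_mulr.
exists (fun y => \matrix_(i, j) rfield (e i) (a j) y); split.
- by move=> c j; under eq_fun do rewrite mxE; exact: cinfty_rfield.
- move=> j; rewrite (_ : (fun y => _) = lfield X (a j)); first exact: cinfty_lfield.
  apply/funext => y; rewrite mxE lfield_rfield_Ad //.
  by apply: eq_bigr => c _; rewrite !mxE.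
- rewrite (_ : \matrix_(_, _) _ = 1%:M) ?det1 ?oner_neq0 //.
  apply/matrixP => c j; rewrite !mxE /rfield /a.
  under eq_fun do rewrite mulgK.
  by rewrite Ehs coord_vbasis_delta.
Qed.

(* Apply lfield Z to lfield_rfield_Ad and use that left- and right-invariant fields commute. *)
Lemma lfield_coord_Ad X Z i y :
  lfield Z (fun y => co i (Ad y X)) y = co i (Ad y (brk Z X)).
Proof.
have [hs [Chs Ehs]] := lam_dual_basis.
pose a := fun z : K => hs i (z * y^-1)%g.
have Ca : cinfty AK a by exact: cinfty_mulr.
have ra W : rfield W a y = co i W.
  by rewrite /rfield /a; under eq_fun do rewrite mulgK; rewrite Ehs.
rewrite -ra -lfield_Ad // lfield_bracket // (lfield_rfield_Ad X Ca).
rewrite (derivation_sum (lfield_derivation Z y)); last first.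
  by move=> j; exact: cinftyM (cinfty_coord_Ad X j) (cinfty_rfield (e j) Ca).
under eq_bigr => j _ do rewrite (derivationM (lfield_derivation Z y)
  (cinfty_coord_Ad X j) (cinfty_rfield (e j) Ca)) lfield_rfield_comm // ra coord_vbasis_delta.
rewrite big_split /= (lfield_rfield_Ad X (cinfty_lfield Z Ca)) /= addrAC subrr add0r.
rewrite (bigD1 i) //= eqxx mul1r big1 ?addr0 // => j ji.
by rewrite (negbTE ji) mul0r.
Qed.

Section Representations.
Variables (n : nat) (rho : K -> 'M[R[i]]_n).
Hypothesis hrho : rep AK rho.

Lemma rep_cinftyC i j : cinftyC AK (fun y => rho y i j).
Proof. by case: hrho => _ _ H; exact: H. Qed.

Lemma derC_lfield_rep X y i j :
  derC (fun h => lfield X h y) (fun y => rho y i j) = (rho y *m drep lam rho X) i j.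
Proof.
case: hrho => _ rM _; rewrite mxE.
transitivity (derC (lam X) (fun z => \sum_l rho y i l * rho z l j)).
  by rewrite /derC /lfield; congr Complex; congr lam; apply/funext => z; rewrite rM mxE.
rewrite (derC_sum (lam_derivation X)); last first.
  by move=> l; apply: cinftyCM (cinftyC_cst _) (rep_cinftyC l j).
apply: eq_bigr => l _; rewrite (derCZ (lam_derivation X) _ (rep_cinftyC l j)).
by rewrite /drep mxE.
Qed.

Lemma derC_rfield_rep X y i j :
  derC (fun h => rfield X h y) (fun y => rho y i j) = (drep lam rho X *m rho y) i j.
Proof.
case: hrho => _ rM _; rewrite mxE.
transitivity (derC (lam X) (fun z => \sum_l rho y l j * rho z i l)).
  rewrite /derC /rfield; congr Complex; congr lam; apply/funext => z; rewrite rM mxE;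
  by under eq_bigr do rewrite mulrC.
rewrite (derC_sum (lam_derivation X)); last first.
  by move=> l; apply: cinftyCM (cinftyC_cst _) (rep_cinftyC i l).
apply: eq_bigr => l _; rewrite (derCZ (lam_derivation X) _ (rep_cinftyC i l)).
by rewrite /drep mxE mulrC.
Qed.

(** This is [lfield_Ad] evaluated on the matrix entries of [rho]: the left-invariant field
    multiplies by [drep] on the right, the right-invariant one on the left. *)
Lemma drep_Ad X y : rho y *m drep lam rho X = drep lam rho (Ad y X) *m rho y.
Proof.
apply/matrixP => i j; rewrite -derC_lfield_rep -derC_rfield_rep.
by have [Cr Ci] := rep_cinftyC i j; rewrite /derC !lfield_Ad.
Qed.

Lemma drep_linear (r : R) X Y :
  drep lam rho (r *: X + Y) = real_complex R r *: drep lam rho X + drep lam rho Y.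
Proof.
apply/matrixP => i j; rewrite !mxE; have [Cr Ci] := rep_cinftyC i j.
rewrite !lam_linear //; apply/eqP; rewrite eq_complex /= !mul0r.
by rewrite subr0 addr0 !eqxx.
Qed.

End Representations.
End LieGroupTheory.

(** * The Poisson tensor of a moment map *)

Section MomentMap.
Context {R : realType}.
Variables (M : topologicalType) (AM : smoothStructure R M) (PM : poisson AM).
Variables (d : nat) (D : 'I_d -> (M -> R) -> M -> R).
Hypothesis cinfty_D : forall i f, cinfty AM f -> cinfty AM (D i f).

Lemma pb_pb_skew f h : cinfty AM f -> cinfty AM h -> PM f h = fun m => - PM h f m.
Proof. by move=> Cf Ch; apply/funext => m; exact: pb_skew. Qed.

(* Gam^-1 {Gam, f} = \sum_i (D i f) x_i. *)
Definition log_derivative (K : topGroupType) (AK : smoothStructure R K) (k : vectType R)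
    (lam : k -> (K -> R) -> R) (x : 'I_d -> k) (Gam : M -> K) : Prop :=
  forall a f m, cinfty AK a -> cinfty AM f ->
    PM (fun p => a (Gam p)) f m = \sum_i D i f m * lfield lam (x i) a (Gam m).

(** Combined with [log_derivative], this makes [P] the coefficient matrix of brackets of two
    pullbacks, see [pb_pullbacks]. *)
Definition poisson_tensor (K : topGroupType) (AK : smoothStructure R K) (k : vectType R)
    (lam : k -> (K -> R) -> R) (x : 'I_d -> k) (Gam : M -> K) (P : M -> 'M[R]_d) : Prop :=
  forall i a m, cinfty AK a ->
    D i (fun p => a (Gam p)) m = \sum_j P m i j * lfield lam (x j) a (Gam m).

Section PoissonTensor.
Variables (K : topGroupType) (AK : smoothStructure R K) (k : vectType R).
Variables (brk : k -> k -> k) (lam : k -> (K -> R) -> R).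
Hypothesis hK : lie_group AK.
Hypothesis hlam : lie_algebra_of AK brk lam.
Variables (x : 'I_d -> k) (xi : 'I_d -> {linear k -> R^o}).
Hypothesis xi_x : forall i j, xi j (x i) = (i == j)%:R.
Variable Gam : M -> K.
Hypothesis sGam : smooth_map (atlas AM) (atlas AK) Gam.
Hypothesis hGam : log_derivative AK lam x Gam.

(* {H_i, B} for functions H_i that are coordinates on K at Gam m: computed through
   log_derivative on the left it is D i B, on the right it is linear in the
   derivatives of B. *)
Lemma poisson_tensor_exists : exists P : M -> 'M[R]_d,
  [/\ forall i j, cinfty AM (fun m => P m i j),
      forall m i j, P m i j = - P m j i &
      poisson_tensor AK lam x Gam P].
Proof.
have H j : exists h, cinfty AK h /\ forall X, lam X h = xi j X.
  by have [h] := lam_dual hlam (xi j); exists h.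
have [hs Hhs] := choice H.
(* Translation by [Gam m] makes the derivatives of these functions along left-invariant fields at
   [Gam m] equal to the forms [xi i]. *)
pose a m i := fun y : K => hs i ((Gam m)^-1 * y)%g.
have Ca m i : cinfty AK (a m i) by apply: (cinfty_mull hK); exact: (Hhs i).1.
have CaG m i : cinfty AM (fun p => a m i (Gam p)) by exact: cinfty_comp sGam (Ca m i).
have la m i X : lfield lam X (a m i) (Gam m) = xi i X.
  rewrite /lfield /a; under eq_fun do rewrite mulKg.
  by rewrite (Hhs i).2.
pose P m : 'M[R]_d := \matrix_(i, j) - D j (fun p => a m i (Gam p)) m.
have HP : poisson_tensor AK lam x Gam P.
  move=> i b m Cb; have CbG := cinfty_comp sGam Cb.
  have := hGam m (Ca m i) CbG; rewrite (bigD1 i) //= big1 ?addr0; last first.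
    by move=> j ji; rewrite la xi_x (negbTE ji) mulr0.
  rewrite la xi_x eqxx mulr1 => <-; rewrite pb_skew // hGam // -sumrN.
  by apply: eq_bigr => j _; rewrite mxE mulNr.
(* The entry [P m j i] is by definition minus this same derivative, so the equality amounts to
   skew-symmetry. *)
have Pa m i j : D i (fun p => a m j (Gam p)) m = P m i j.
  rewrite (HP _ _ _ (Ca m j)) (bigD1 j) //= big1 ?addr0.
    by rewrite la xi_x eqxx mulr1.
  by move=> l lj; rewrite la xi_x (negbTE lj) mulr0.
exists P; split=> // [i j|m i j]; last by rewrite -(Pa m j i) [LHS]mxE.
suff /(_ j) : forall j, cinfty AM (fun m => (\row_j P m i j) 0 j).
  by under eq_fun do rewrite mxE.
apply: cinfty_solve => m0.
(* The coordinates are now frozen at [m0], so the coefficients vary smoothly with [m] and form the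
   identity matrix at [m0]. *)
exists (fun m => \matrix_(l, j) lfield lam (x l) (a m0 j) (Gam m)); split.
- move=> l c; under eq_fun do rewrite mxE.
  apply: (cinfty_comp (h := lfield lam (x l) (a m0 c)) sGam).
  exact: (cinfty_lfield hK hlam).
- move=> c; rewrite (_ : (fun m => _) = D i (fun p => a m0 c (Gam p))).
    exact: cinfty_D.
  apply/funext => m; rewrite (HP i (a m0 c) m) // mxE.
  by apply: eq_bigr => l _; rewrite mxE; congr (_ * _); rewrite mxE.
- rewrite (_ : \matrix_(_, _) _ = 1%:M) ?det1 ?oner_neq0 //.
  by apply/matrixP => l c; rewrite [LHS]mxE la xi_x mxE.
Qed.

Section Homomorphism.
Variables (K' : topGroupType) (AK' : smoothStructure R K') (k' : vectType R).
Variables (brk' : k' -> k' -> k') (lam' : k' -> (K' -> R) -> R).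
Hypothesis hK' : lie_group AK'.
Variables (Phi : K -> K') (y : 'I_d -> k').
Hypothesis hPhi : lie_group_hom AK AK' Phi.
Hypothesis lamPhi : forall i h, cinfty AK' h -> lam (x i) (h \o Phi) = lam' (y i) h.

Lemma lfield_hom i a u : cinfty AK' a ->
  lfield lam (x i) (fun z => a (Phi z)) u = lfield lam' (y i) a (Phi u).
Proof.
move=> Ca; rewrite /lfield -lamPhi; last exact: cinfty_mull.
by congr lam; apply/funext => z; rewrite /= hPhi.2.
Qed.

Lemma log_derivative_hom : log_derivative AK' lam' y (Phi \o Gam).
Proof.
move=> a f m Ca Cf; rewrite (hGam (a := fun z => a (Phi z))) //.
  by apply: eq_bigr => i _; rewrite lfield_hom.
exact: cinfty_comp hPhi.1 Ca.
Qed.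

(** A homomorphism replaces [x i] by [y i] and leaves [P] alone; hence one tensor serves all sign
    choices. *)
Lemma poisson_tensor_hom P :
  poisson_tensor AK lam x Gam P -> poisson_tensor AK' lam' y (Phi \o Gam) P.
Proof.
move=> HP i a m Ca; rewrite (HP i (fun z => a (Phi z)) m).
  by apply: eq_bigr => j _; rewrite lfield_hom.
exact: cinfty_comp hPhi.1 Ca.
Qed.

End Homomorphism.
End PoissonTensor.

(** * The Jacobi identity for two pullbacks and an arbitrary function *)

Section Jacobi.
Variables (K : topGroupType) (AK : smoothStructure R K) (k : vectType R).
Variables (brk : k -> k -> k) (lam : k -> (K -> R) -> R).
Hypothesis hK : lie_group AK.
Hypothesis hlam : lie_algebra_of AK brk lam.
Variables (x y : 'I_d -> k) (Gs Gt : M -> K) (P : M -> 'M[R]_d).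
Hypothesis sGs : forall h, cinfty AK h -> cinfty AM (fun m => h (Gs m)).
Hypothesis sGt : forall h, cinfty AK h -> cinfty AM (fun m => h (Gt m)).
Hypothesis cinfty_P : forall i j, cinfty AM (fun m => P m i j).
Hypothesis P_skew : forall m i j, P m i j = - P m j i.
Hypothesis hGs : log_derivative AK lam x Gs.
Hypothesis hGt : log_derivative AK lam y Gt.
Hypothesis PGs : poisson_tensor AK lam x Gs P.
Hypothesis PGt : poisson_tensor AK lam y Gt P.
Variable q : 'I_d -> 'I_d -> 'I_d -> R.
Hypothesis D_comm : forall i j f m, cinfty AM f ->
  D i (D j f) m - D j (D i f) m = \sum_l D l f m * q l i j.

Let cinfty_lG X a (G : M -> K) :
  (forall h, cinfty AK h -> cinfty AM (fun m => h (G m))) -> cinfty AK a ->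
  cinfty AM (fun m => lfield lam X a (G m)).
Proof.
by move=> sG Ca; apply: (sG (lfield lam X a)); exact: (cinfty_lfield hK hlam).
Qed.

Lemma pb_pullbacks a b m : cinfty AK a -> cinfty AK b ->
  PM (fun p => a (Gs p)) (fun p => b (Gt p)) m =
  \sum_i \sum_j P m i j * (lfield lam (x i) a (Gs m) * lfield lam (y j) b (Gt m)).
Proof.
move=> Ca Cb; rewrite hGs //; last exact: sGt Cb.
apply: eq_bigr => i _; rewrite PGt // mulr_suml; apply: eq_bigr => j _.
by rewrite -mulrA [X in _ * X]mulrC.
Qed.

(** In the Jacobi identity for [a o Gs], [b o Gt] and [f], the second derivatives of [f] combine
    into commutators of the [D i], and those of [a] and [b] into brackets of invariant fields, so
    only first derivatives remain. *)
Lemma jacobi_pullbacks a b f m : cinfty AK a -> cinfty AK b -> cinfty AM f ->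
  let l X a := lfield lam X a (Gs m) in let r X b := lfield lam X b (Gt m) in
  \sum_i \sum_j PM (fun p => P p i j) f m * (l (x i) a * r (y j) b) =
  \sum_n D n f m * \sum_i \sum_j
    (P m i j * (l (brk (x i) (x n)) a * r (y j) b + l (x i) a * r (brk (y j) (y n)) b)
     + q n i j * (l (x i) a * r (y j) b)).
Proof.
move=> Ca Cb Cf l r.
have CA := sGs Ca; have CB := sGt Cb.
set A := (fun p => a (Gs p)) in CA *; set B := (fun p => b (Gt p)) in CB *.
pose ai i := fun p => lfield lam (x i) a (Gs p).
pose bj j := fun p => lfield lam (y j) b (Gt p).
have Cai i : cinfty AM (ai i) by exact: cinfty_lG.
have Cbj j : cinfty AM (bj j) by exact: cinfty_lG.
pose aa n i := lfield lam (x n) (lfield lam (x i) a) (Gs m).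
pose bb n j := lfield lam (y n) (lfield lam (y j) b) (Gt m).
have Cla X : cinfty AK (lfield lam X a) by exact: (cinfty_lfield hK hlam).
have Clb X : cinfty AK (lfield lam X b) by exact: (cinfty_lfield hK hlam).
have aif i h : cinfty AM h -> PM (ai i) h m = \sum_n D n h m * aa n i.
  by move=> Ch; rewrite /ai hGs.
have bjf j h : cinfty AM h -> PM (bj j) h m = \sum_n D n h m * bb n j.
  by move=> Ch; rewrite /bj hGt.
have Af h : cinfty AM h -> PM A h = fun p => \sum_n D n h p * ai n p.
  by move=> Ch; apply/funext => p; rewrite /A hGs.
have Bf h : cinfty AM h -> PM B h = fun p => \sum_n D n h p * bj n p.
  by move=> Ch; apply/funext => p; rewrite /B hGt.
have CDa n : cinfty AM (fun p => D n f p * ai n p) by exact: cinftyM (cinfty_D n Cf) (Cai n).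
have CDb n : cinfty AM (fun p => D n f p * bj n p) by exact: cinftyM (cinfty_D n Cf) (Cbj n).
have DA i : D i A m = \sum_j P m i j * ai j m by rewrite /A PGs.
have DB i : D i B m = \sum_j P m i j * bj j m by rewrite /B PGt.
have dB := pb_derivation PM m CB; have dA := pb_derivation PM m CA.
have df := pb_derivation PM m Cf.
(* The Jacobi identity in the form {{A, B}, f} = {{A, f}, B} - {{B, f}, A}. *)
have jac : PM (PM A B) f m =
    PM (fun p => \sum_n D n f p * ai n p) B m - PM (fun p => \sum_n D n f p * bj n p) A m.
  have := pb_jacobi PM CA CB Cf m.
  rewrite (pb_skew PM Cf (pb_smooth PM CA CB)) (pb_pb_skew Cf CA) (Af f Cf) (Bf f Cf).
  have CsA := cinfty_sum (index_enum 'I_d) xpredT CDa.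
  have CsB := cinfty_sum (index_enum 'I_d) xpredT CDb.
  rewrite (pb_skew PM CA CsB) (pb_skew PM CB (cinftyN CsA)) (derivationN dB CsA).
  by rewrite opprK => /eqP; rewrite subr_eq0 => /eqP <-; rewrite addrC.
have AB : PM A B = fun p => \sum_i \sum_j P p i j * (ai i p * bj j p).
  by apply/funext => p; rewrite pb_pullbacks.
have Cab i j : cinfty AM (fun p => ai i p * bj j p) by exact: cinftyM.
have CPab i j : cinfty AM (fun p => P p i j * (ai i p * bj j p)) by exact: cinftyM.
have lhs : PM (PM A B) f m = \sum_i \sum_j
    (P m i j * (ai i m * (\sum_n D n f m * bb n j) + bj j m * (\sum_n D n f m * aa n i))
     + ai i m * bj j m * PM (fun p => P p i j) f m).
  rewrite AB (derivation_sum df); last by move=> i; exact: cinfty_sum.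
  apply: eq_bigr => i _; rewrite (derivation_sum df) //.
  apply: eq_bigr => j _; rewrite (derivationM df (cinfty_P i j) (Cab i j)).
  by rewrite (derivationM df (Cai i) (Cbj j)) aif // bjf.
have PfA n : PM (D n f) A m = - \sum_i D i (D n f) m * ai i m.
  by rewrite (pb_skew PM (cinfty_D n Cf) CA) (Af _ (cinfty_D n Cf)).
have PfB n : PM (D n f) B m = - \sum_i D i (D n f) m * bj i m.
  by rewrite (pb_skew PM (cinfty_D n Cf) CB) (Bf _ (cinfty_D n Cf)).
have rhs1 : PM (fun p => \sum_n D n f p * ai n p) B m = \sum_n
    (D n f m * (\sum_i (\sum_j P m i j * bj j m) * aa i n)
     + ai n m * - (\sum_i D i (D n f) m * bj i m)).
  rewrite (derivation_sum dB) //; apply: eq_bigr => n _.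
  rewrite (derivationM dB (cinfty_D n Cf) (Cai n)) PfB aif //.
  by under eq_bigr do rewrite DB.
have rhs2 : PM (fun p => \sum_n D n f p * bj n p) A m = \sum_n
    (D n f m * (\sum_i (\sum_j P m i j * ai j m) * bb i n)
     + bj n m * - (\sum_i D i (D n f) m * ai i m)).
  rewrite (derivation_sum dA) //; apply: eq_bigr => n _.
  rewrite (derivationM dA (cinfty_D n Cf) (Cbj n)) PfA bjf //.
  by under eq_bigr do rewrite DA.
have sum3 (X : 'I_d -> R) (T : 'I_d -> 'I_d -> 'I_d -> R) :
    \sum_n X n * (\sum_i \sum_j T n i j) = \sum_i \sum_j \sum_n X n * T n i j.
  under eq_bigr do rewrite mulr_sumr; rewrite exchange_big; apply: eq_bigr => i _.
  by under eq_bigr do rewrite mulr_sumr; rewrite exchange_big.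
have r1 : PM (fun p => \sum_n D n f p * ai n p) B m = \sum_i \sum_j
    ((\sum_n D n f m * (P m i j * bj j m * aa i n)) - D j (D i f) m * (ai i m * bj j m)).
  rewrite rhs1 big_split /=; under [RHS]eq_bigr do rewrite big_split /=.
  rewrite [RHS]big_split /=; congr (_ + _).
    rewrite -sum3; apply: eq_bigr => n _; congr (_ * _); apply: eq_bigr => i _.
    by rewrite mulr_suml.
  apply: eq_bigr => i _; rewrite mulrN mulr_sumr -sumrN; apply: eq_bigr => j _.
  by congr (- _); ring.
(* Interchanging the summation indices transposes [P]; [P_skew] undoes this at the cost of the minus
   sign in front of the first sum. *)
have r2 : PM (fun p => \sum_n D n f p * bj n p) A m = \sum_i \sum_j
    (- (\sum_n D n f m * (P m i j * ai i m * bb j n)) - D i (D j f) m * (ai i m * bj j m)).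
  rewrite rhs2 big_split /=; under [RHS]eq_bigr do rewrite big_split /=.
  rewrite [RHS]big_split /=; congr (_ + _).
    under [RHS]eq_bigr do rewrite sumrN; rewrite sumrN -sum3 -sumrN.
    apply: eq_bigr => n _; rewrite -mulrN; congr (_ * _); rewrite exchange_big /= -sumrN.
    apply: eq_bigr => i _; rewrite mulr_suml -sumrN; apply: eq_bigr => j _.
    by rewrite (P_skew m i j) !mulNr.
  rewrite exchange_big /=; apply: eq_bigr => i _.
  rewrite mulrN mulr_sumr -sumrN; apply: eq_bigr => j _.
  by congr (- _); ring.
move: jac; rewrite lhs r1 r2 => jac.
(* The Leibniz terms in which [f] acts on [ai] and [bj] are subtracted, to isolate the bracket of
   [P] with [f]. *)
transitivity (\sum_i \sum_j ((P m i j * (ai i m * (\sum_n D n f m * bb n j) +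
    bj j m * (\sum_n D n f m * aa n i)) + ai i m * bj j m * PM (fun p => P p i j) f m)
    - P m i j * (ai i m * (\sum_n D n f m * bb n j) + bj j m * (\sum_n D n f m * aa n i)))).
  by apply: eq_bigr => i _; apply: eq_bigr => j _; rewrite /l /r /ai /bj; ring.
under eq_bigr do rewrite sumrB; rewrite sumrB jac sum3 -!sumrB.
apply: eq_bigr => i _; rewrite -!sumrB; apply: eq_bigr => j _.
have -> : \sum_n D n f m *
    (P m i j * (l (brk (x i) (x n)) a * r (y j) b + l (x i) a * r (brk (y j) (y n)) b)
     + q n i j * (l (x i) a * r (y j) b)) =
   P m i j * bj j m * (\sum_n D n f m * aa i n) - P m i j * bj j m * (\sum_n D n f m * aa n i)
   + P m i j * ai i m * (\sum_n D n f m * bb j n) - P m i j * ai i m * (\sum_n D n f m * bb n j)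
   + (\sum_n D n f m * q n i j) * (ai i m * bj j m).
  rewrite mulr_suml !mulr_sumr -sumrB -big_split -sumrB -big_split /=.
  apply: eq_bigr => n _; rewrite /l /r !(lfield_bracket hK hlam) // -/(ai _ _) -/(bj _ _).
  rewrite -/(aa i n) -/(aa n i) -/(bb j n) -/(bb n j) /ai /bj.
  ring.
rewrite -D_comm //.
have -> : \sum_n D n f m * (P m i j * bj j m * aa i n) =
    P m i j * bj j m * (\sum_n D n f m * aa i n).
  by rewrite mulr_sumr; apply: eq_bigr => n _; ring.
have -> : \sum_n D n f m * (P m i j * ai i m * bb j n) =
    P m i j * ai i m * (\sum_n D n f m * bb j n).
  by rewrite mulr_sumr; apply: eq_bigr => n _; ring.
ring.
Qed.

End Jacobi.
End MomentMap.

(** * Exchange relations *)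

Section TensorAlgebra.
Context {R : realType}.
Local Notation C := R[i].

Lemma tensmxDl m n p q (A A' : 'M[C]_(m, n)) (B : 'M[C]_(p, q)) :
  (A + A') *t B = A *t B + A' *t B.
Proof. by apply/matrixP => i j; rewrite !mxE mulrDl. Qed.

Lemma tensmxDr m n p q (A : 'M[C]_(m, n)) (B B' : 'M[C]_(p, q)) :
  A *t (B + B') = A *t B + A *t B'.
Proof. by apply/matrixP => i j; rewrite !mxE mulrDr. Qed.

Lemma tensmxZl m n p q (c : C) (A : 'M[C]_(m, n)) (B : 'M[C]_(p, q)) :
  (c *: A) *t B = c *: (A *t B).
Proof. by apply/matrixP => i j; rewrite !mxE mulrA. Qed.

Lemma tensmxZr m n p q (c : C) (A : 'M[C]_(m, n)) (B : 'M[C]_(p, q)) :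
  A *t (c *: B) = c *: (A *t B).
Proof. by apply/matrixP => i j; rewrite !mxE mulrCA. Qed.

Lemma tensmx_suml (I : Type) (s : seq I) m n p q (A : I -> 'M[C]_(m, n)) (B : 'M[C]_(p, q)) :
  (\sum_(i <- s) A i) *t B = \sum_(i <- s) A i *t B.
Proof. by elim/big_rec2: _ => [|i X Y _ <-]; rewrite ?tens0mx ?tensmxDl. Qed.

Lemma tensmx_sumr (I : Type) (s : seq I) m n p q (A : 'M[C]_(m, n)) (B : I -> 'M[C]_(p, q)) :
  A *t (\sum_(i <- s) B i) = \sum_(i <- s) A *t B i.
Proof. by elim/big_rec2: _ => [|i X Y _ <-]; rewrite ?tensmx0 ?tensmxDr. Qed.

Lemma tensmx_delta n (U V : 'M[C]_n) :
  U *t V = \sum_i \sum_j \sum_k \sum_l (U i j * V k l) *: (delta_mx i j *t delta_mx k l).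
Proof.
rewrite {1}(matrix_sum_delta U) {1}(matrix_sum_delta V) tensmx_suml.
apply: eq_bigr => i _; rewrite tensmx_suml; apply: eq_bigr => j _.
rewrite tensmx_sumr; apply: eq_bigr => k _; rewrite tensmx_sumr; apply: eq_bigr => l _.
by rewrite tensmxZl tensmxZr scalerA.
Qed.

Section Tensor.
Variables (d n : nat) (E : 'I_d -> 'M[C]_n).
Implicit Types T : 'M[C]_d.

Lemma tensorD T T' : tensor E (T + T') = tensor E T + tensor E T'.
Proof.
rewrite /tensor -big_split; apply: eq_bigr => i _; rewrite -big_split.
by apply: eq_bigr => j _; rewrite mxE scalerDl.
Qed.

Lemma tensorZ (c : C) T : tensor E (c *: T) = c *: tensor E T.
Proof.
rewrite /tensor scaler_sumr; apply: eq_bigr => i _; rewrite scaler_sumr.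
by apply: eq_bigr => j _; rewrite mxE scalerA.
Qed.

Lemma tensorN T : tensor E (- T) = - tensor E T.
Proof. by rewrite -scaleN1r tensorZ scaleN1r. Qed.

(** Row [a] of [A] lists the image of the [a]-th basis vector, so [A^T *m T *m B] is the tensor [T]
    with [A] applied to its first leg and [B] to its second. *)
Lemma tensor_conj (A B T : 'M[C]_d) :
  tensor E (A^T *m T *m B) =
  \sum_a \sum_b T a b *: ((\sum_i A a i *: E i) *t (\sum_j B b j *: E j)).
Proof.
under [RHS]eq_bigr => a _.
  under eq_bigr => b _.
    rewrite tensmx_suml scaler_sumr.
    under eq_bigr => i _.
      rewrite tensmx_sumr scaler_sumr.
      under eq_bigr => j _ do rewrite tensmxZl tensmxZr !scalerA.
      over.
    over.
  rewrite exchange_big /=.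
  under eq_bigr => i _ do rewrite exchange_big /=.
  over.
rewrite exchange_big /= /tensor; apply: eq_bigr => i _.
rewrite exchange_big /=; apply: eq_bigr => j _.
under eq_bigr do rewrite -scaler_suml; rewrite -scaler_suml; congr (_ *: _).
rewrite !mxE; under eq_bigr do rewrite mxE mulr_suml.
rewrite exchange_big /=; apply: eq_bigr => a _; apply: eq_bigr => b _.
by rewrite [A^T _ _]mxE; ring.
Qed.

End Tensor.

Lemma leg12 n (X Y : 'M[C]_n) : leg1 X *m leg2 Y = X *t Y.
Proof. by rewrite /leg1 /leg2 tensmx_mul mulmx1 mul1mx. Qed.

Lemma Complex_sum (I : Type) (s : seq I) (F H : I -> R) :
  Complex (\sum_(i <- s) F i) (\sum_(i <- s) H i) = \sum_(i <- s) Complex (F i) (H i).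
Proof. by elim: s => [|i s IH]; rewrite ?big_nil // !big_cons -IH. Qed.

Lemma trmx_triple d m n (X : 'M[R]_(d, m)) (P : 'M[R]_d) (Y : 'M[R]_(d, n)) a b :
  (X^T *m P *m Y) a b = \sum_i \sum_j P i j * (X i a * Y j b).
Proof.
rewrite mxE; under eq_bigr do rewrite mxE mulr_suml.
rewrite exchange_big; apply: eq_bigr => i _; apply: eq_bigr => j _.
by rewrite mxE; ring.
Qed.

End TensorAlgebra.

(** * Derivations applied entrywise to matrices of functions *)

Section MatrixDerivation.
Context {R : realType} {T : topologicalType} {A : smoothStructure R T}.
Context {p : T} {D : (T -> R) -> R}.
Hypothesis dD : derivation A p D.

Definition cinfty_mx a b (F : T -> 'M[R[i]]_(a, b)) : Prop :=
  forall i j, cinftyC A (fun x => F x i j).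

Definition der_mx a b (F : T -> 'M[R[i]]_(a, b)) : 'M[R[i]]_(a, b) :=
  \matrix_(i, j) derC D (fun x => F x i j).

Lemma cinfty_mx_cst a b (X : 'M[R[i]]_(a, b)) : cinfty_mx (fun=> X).
Proof. by move=> i j; exact: cinftyC_cst. Qed.

Lemma cinfty_mx_add a b (F H : T -> 'M[R[i]]_(a, b)) :
  cinfty_mx F -> cinfty_mx H -> cinfty_mx (fun x => F x + H x).
Proof. by move=> CF CH i j; under eq_fun do rewrite mxE; exact: cinftyCD. Qed.

Lemma cinfty_mx_mul a b c (F : T -> 'M[R[i]]_(a, b)) (H : T -> 'M[R[i]]_(b, c)) :
  cinfty_mx F -> cinfty_mx H -> cinfty_mx (fun x => F x *m H x).
Proof.
move=> CF CH i j; under eq_fun do rewrite mxE.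
by apply: (cinftyC_sum _ _ (F := fun l x => F x i l * H x l j)) => l; exact: cinftyCM.
Qed.

Lemma cinfty_mx_tr a b (F : T -> 'M[R[i]]_(a, b)) : cinfty_mx F -> cinfty_mx (fun x => (F x)^T).
Proof. by move=> CF i j; under eq_fun do rewrite mxE. Qed.

Lemma der_mx_cst a b (X : 'M[R[i]]_(a, b)) : der_mx (fun=> X) = 0.
Proof. by apply/matrixP => i j; rewrite !mxE (derC_cst dD). Qed.

Lemma der_mx_add a b (F H : T -> 'M[R[i]]_(a, b)) : cinfty_mx F -> cinfty_mx H ->
  der_mx (fun x => F x + H x) = der_mx F + der_mx H.
Proof.
move=> CF CH; apply/matrixP => i j; rewrite !mxE -(derCD dD) //.
by congr derC; apply/funext => x; rewrite mxE.
Qed.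

Lemma der_mx_mul a b c (F : T -> 'M[R[i]]_(a, b)) (H : T -> 'M[R[i]]_(b, c)) :
  cinfty_mx F -> cinfty_mx H -> der_mx (fun x => F x *m H x) = der_mx F *m H p + F p *m der_mx H.
Proof.
move=> CF CH; apply/matrixP => i j; rewrite !mxE.
transitivity (derC D (fun x => \sum_l F x i l * H x l j)).
  by congr derC; apply/funext => x; rewrite mxE.
rewrite (derC_sum dD); last by move=> l; exact: cinftyCM.
rewrite -big_split; apply: eq_bigr => l _; rewrite !mxE (derCM dD) //.
by rewrite addrC [X in X + _]mulrC.
Qed.

Lemma der_mx_tr a b (F : T -> 'M[R[i]]_(a, b)) : der_mx (fun x => (F x)^T) = (der_mx F)^T.
Proof.
apply/matrixP => i j; rewrite !mxE; congr derC; apply/funext => x; rewrite mxE //.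
Qed.

End MatrixDerivation.
Arguments cinfty_mx {R T} A {a b} F.
Arguments der_mx {R T} D {a b} F.

(** * The central tensor N and the exchange relations, for any target group with complex coordinates
    on its Lie algebra *)

Section Exchange.
Context {R : realType}.
Variables (M : topologicalType) (AM : smoothStructure R M) (PM : poisson AM).
Variables (d : nat) (D : 'I_d -> (M -> R) -> M -> R).
Hypothesis cinfty_D : forall i f, cinfty AM f -> cinfty AM (D i f).
Variables (K : topGroupType) (AK : smoothStructure R K) (k : vectType R).
Variables (brk : k -> k -> k) (lam : k -> (K -> R) -> R).
Hypothesis hK : lie_group AK.
Hypothesis hlam : lie_algebra_of AK brk lam.
Hypothesis brk_skew : forall X Y, brk X Y = - brk Y X.
Variables (x : bool -> 'I_d -> k) (G : bool -> M -> K) (P : M -> 'M[R]_d).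
Hypothesis sG : forall s h, cinfty AK h -> cinfty AM (fun m => h (G s m)).
Hypothesis cinfty_P : forall i j, cinfty AM (fun m => P m i j).
Hypothesis P_skew : forall m i j, P m i j = - P m j i.
Hypothesis hG : forall s, log_derivative PM D AK lam (x s) (G s).
Hypothesis PG : forall s, poisson_tensor D AK lam (x s) (G s) P.
Variable Q : 'I_d -> 'M[R]_d.
Hypothesis D_comm : forall i j f m, cinfty AM f ->
  D i (D j f) m - D j (D i f) m = \sum_l D l f m * - Q l i j.

Local Notation "r %:C" := (real_complex R r).
Local Notation "X ^rc" := (map_mx (real_complex R) X) (at level 1, format "X ^rc").

Let dk := \dim {:k}.
Let co (i : 'I_dk) : k -> R := coord (vbasis {:k}) i.
Let ek (i : 'I_dk) : k := (vbasis {:k})`_i.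

Let Xm s : 'M[R]_(d, dk) := \matrix_(i, a) co a (x s i).
Let Bm s l : 'M[R]_(d, dk) := \matrix_(i, a) co a (brk (x s i) (x s l)).

(** Test functions with coordinate forms as differentials at [G s m] and [G t m] extract the
    components. The outer factors [Xm] stay, since the [x s i] may be linearly dependent. *)
Lemma jacobi_matrix s t f m : cinfty AM f ->
  (Xm s)^T *m (\matrix_(i, j) PM (fun p => P p i j) f m) *m Xm t =
  \sum_l D l f m *: ((Bm s l)^T *m P m *m Xm t + (Xm s)^T *m P m *m Bm t l
                     - (Xm s)^T *m Q l *m Xm t).
Proof.
move=> Cf; apply/matrixP => a b; rewrite trmx_triple summxE.
have [h Ch lh] := lam_dual hlam (coord (vbasis {:k}) a).
have [h' Ch' lh'] := lam_dual hlam (coord (vbasis {:k}) b).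
have la X : lfield lam X (fun z => h ((G s m)^-1 * z)%g) (G s m) = co a X.
  by rewrite /lfield; under eq_fun do rewrite mulKg; rewrite lh.
have lb X : lfield lam X (fun z => h' ((G t m)^-1 * z)%g) (G t m) = co b X.
  by rewrite /lfield; under eq_fun do rewrite mulKg; rewrite lh'.
have Ca := cinfty_mull hK (G s m)^-1%g Ch.
have Cb := cinfty_mull hK (G t m)^-1%g Ch'.
have := jacobi_pullbacks cinfty_D hK hlam (sG s) (sG t) cinfty_P P_skew (hG s) (hG t)
  (PG s) (PG t) D_comm m Ca Cb Cf.
cbv beta zeta.
under eq_bigr do under eq_bigr do rewrite la lb.
under [X in _ = X -> _]eq_bigr do under eq_bigr do under eq_bigr do rewrite !la !lb.
move=> H; transitivity (\sum_i \sum_j PM (fun p => P p i j) f m *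
    (co a (x s i) * co b (x t j))).
  by apply: eq_bigr => i _; apply: eq_bigr => j _; rewrite !mxE.
rewrite H; apply: eq_bigr => l _; rewrite mxE; congr (_ * _).
have -> (U V W : 'M[R]_dk) : (U + V - W) a b = U a b + V a b - W a b.
  by rewrite [LHS]mxE [X in X + _]mxE [X in _ + X]mxE.
rewrite !trmx_triple -big_split -sumrB; apply: eq_bigr => i _.
rewrite -big_split -sumrB; apply: eq_bigr => j _ /=.
by rewrite !mxE; ring.
Qed.

Variables (z : k -> 'rV[R[i]]_d) (E : 'I_d -> k).
Hypothesis z_linear : forall r X Y, z (r *: X + Y) = r%:C *: z X + z Y.

(** Here [k] is g or the realification of its complexification, of real dimension [dk]; [z] reads
    off the [d] complex coordinates along [E], and [Wm] converts real coordinates into them. *)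
Let Wm : 'M[R[i]]_(dk, d) := \matrix_(a, p) z (ek a) 0 p.

Lemma z_expand X p : z X 0 p = \sum_a (co a X)%:C * Wm a p.
Proof.
have z0 : z 0 = 0.
  have := z_linear 1 0 0; rewrite scaler0 addr0 rmorph1 scale1r => /eqP.
  by rewrite -subr_eq0 opprD addrA subrr sub0r oppr_eq0 => /eqP.
have zs (r : seq 'I_dk) : z (\sum_(a <- r) co a X *: ek a) 0 p =
    \sum_(a <- r) (co a X)%:C * Wm a p.
  elim: r => [|a r IH]; first by rewrite !big_nil z0 mxE.
  by rewrite !big_cons z_linear -IH !mxE.
by rewrite -zs /co /ek -(coord_vbasis (memvf X)).
Qed.

Lemma zN X : z (- X) = - z X.
Proof.
by apply/rowP => p; rewrite mxE !z_expand -sumrN; apply: eq_bigr => a _;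
   rewrite /co linearN rmorphN mulNr.
Qed.

Let adm X : 'M[R[i]]_d := \matrix_(a, p) z (brk X (E a)) 0 p.
Let Adm y : 'M[R[i]]_d := \matrix_(a, p) z (Ad hK hlam y (E a)) 0 p.
Let Zm s : 'M[R[i]]_d := \matrix_(i, p) z (x s i) 0 p.

Hypothesis z_br : forall X Y, z (brk X Y) = z Y *m adm X.
Hypothesis z_Ad : forall y X, z (Ad hK hlam y X) = z X *m Adm y.

Variables (gam : R) (r : bool -> bool -> 'M[R[i]]_d).
Hypothesis r_identity : forall s t l,
  gam%:C *: ((adm (x s l))^T *m r s t + r s t *m adm (x t l)) =
  (Zm s)^T *m (Q l)^rc *m Zm t.

Lemma z_matrix n (F : 'I_n -> k) :
  \matrix_(i, p) z (F i) 0 p = (\matrix_(i, a) co a (F i))^rc *m Wm.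
Proof.
apply/matrixP => i p; rewrite !mxE z_expand; apply: eq_bigr => a _.
by rewrite !mxE.
Qed.

(** The sign reflects that [Bm] brackets with [x s l] on the right, [adm] on the left. *)
Lemma z_bracket_matrix s l :
  (Bm s l)^rc *m Wm = - (Zm s *m adm (x s l)).
Proof.
rewrite -z_matrix; apply/matrixP => i p; rewrite mxE brk_skew zN z_br !mxE.
by congr (- _); apply: eq_bigr => a _; rewrite !mxE.
Qed.

(** [Pi] obeys an affine law with stationary point [- gam%:C *: r s t]; measured from that point, as
    [S], it obeys a linear one, and [N] undoes the adjoint evolution of [S]. *)
Let Pi s t m := (Zm s)^T *m (P m)^rc *m Zm t.
Let S s t m := Pi s t m + gam%:C *: r s t.
Let N s t m := (Adm (G s m))^T *m S s t m *m Adm (G t m) - gam%:C *: r s t.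

(** [r_identity] rewrites the inhomogeneous term [Q l] as the adjoint action on [r], which turns
    [Pi] into [S] on the right. *)
Lemma jacobi_complex s t f m : cinfty AM f ->
  (Zm s)^T *m (\matrix_(i, j) PM (fun p => P p i j) f m)^rc *m Zm t =
  - \sum_l (D l f m)%:C *: ((adm (x s l))^T *m S s t m + S s t m *m adm (x t l)).
Proof.
move=> Cf; have ZE u : Zm u = (Xm u)^rc *m Wm by rewrite /Zm z_matrix.
have conj (n1 n2 : nat) (X : 'M[R]_(n1, dk)) (T : 'M[R]_(n1, n2)) (Y : 'M[R]_(n2, dk)) :
    (X^rc *m Wm)^T *m T^rc *m (Y^rc *m Wm) = Wm^T *m (X^T *m T *m Y)^rc *m Wm.
  by rewrite !map_mxM trmx_mul map_trmx !mulmxA.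
rewrite [in LHS](ZE s) [in LHS](ZE t) conj jacobi_matrix //.
rewrite (raddf_sum (map_mx (real_complex R))) mulmx_sumr mulmx_suml -sumrN.
apply: eq_bigr => l _ /=.
rewrite map_mxZ -scalemxAr -scalemxAl -scalerN; congr (_ *: _).
rewrite map_mxB map_mxD mulmxBr mulmxDr mulmxBl mulmxDl -!conj -!ZE.
rewrite !z_bracket_matrix -r_identity -/(Pi s t m) /S.
rewrite linearN /= trmx_mul !mulNmx mulmxN mulmxDr mulmxDl -scalemxAr -scalemxAl scalerDr.
rewrite -/(Pi s t m) /Pi !mulmxA !opprD !addrA; congr (_ + _).
by rewrite addrAC.
Qed.

Lemma cinftyC_zAd Y p : cinftyC AK (fun y => z (Ad hK hlam y Y) 0 p).
Proof.
under eq_fun do rewrite z_expand.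
apply: (cinftyC_sum _ _ (F := fun a y => (co a (Ad hK hlam y Y))%:C * Wm a p)) => a.
apply: cinftyCM (cinftyC_cst _); apply: cinftyC_real.
exact: cinfty_coord_Ad.
Qed.

Lemma cinfty_mx_AdG s : cinfty_mx AM (fun m => Adm (G s m)).
Proof.
move=> a p; have [Cr Ci] := cinftyC_zAd (E a) p.
split; under eq_fun do rewrite mxE.
  exact: (sG s Cr).
exact: (sG s Ci).
Qed.

(** The derivative of [Ad] along a left-invariant field is [Ad] after the bracket, by
    [lfield_coord_Ad]; the factors appear in reverse order because coordinates are row vectors. *)
Lemma der_mx_AdG s f m : cinfty AM f ->
  der_mx (fun h => PM h f m) (fun p => Adm (G s p)) =
  \sum_l (D l f m)%:C *: (adm (x s l) *m Adm (G s m)).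
Proof.
move=> Cf; have df := pb_derivation PM m Cf; apply/matrixP => a p.
rewrite mxE summxE.
transitivity (derC (fun h => PM h f m)
    (fun u => \sum_b Wm b p * (co b (Ad hK hlam (G s u) (E a)))%:C)).
  by congr derC; apply/funext => u; rewrite mxE z_expand; apply: eq_bigr => b _; rewrite mulrC.
have Cb b : cinfty AM (fun u => co b (Ad hK hlam (G s u) (E a))).
  exact: (sG s (cinfty_coord_Ad hK hlam (E a) b)).
rewrite (derC_sum df); last first.
  by move=> b; apply: cinftyCM (cinftyC_cst _) (cinftyC_real (Cb b)).
under eq_bigr => b _.
  rewrite (derCZ df _ (cinftyC_real (Cb b))) (derC_real df).
  rewrite (hG s m (cinfty_coord_Ad hK hlam (E a) b) Cf) rmorph_sum mulr_sumr /=.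
  under eq_bigr => l _ do rewrite rmorphM (lfield_coord_Ad hK hlam) mulrCA.
  over.
rewrite exchange_big /=; apply: eq_bigr => l _.
rewrite -mulr_sumr [RHS]mxE; congr (_ * _).
transitivity (z (Ad hK hlam (G s m) (brk (x s l) (E a))) 0 p).
  by rewrite z_expand; apply: eq_bigr => b _; rewrite mulrC.
by rewrite z_Ad mxE [RHS]mxE; apply: eq_bigr => b _; rewrite [in RHS]mxE.
Qed.

Lemma cinfty_mx_PC : cinfty_mx AM (fun m => (P m)^rc).
Proof.
by move=> i j; under eq_fun do rewrite mxE; exact: cinftyC_real.
Qed.

Lemma cinfty_mx_S s t : cinfty_mx AM (S s t).
Proof.
apply: cinfty_mx_add (cinfty_mx_cst _).
by apply: cinfty_mx_mul (cinfty_mx_cst _); apply: cinfty_mx_mul (cinfty_mx_cst _) cinfty_mx_PC.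
Qed.

Lemma cinfty_mx_N s t : cinfty_mx AM (N s t).
Proof.
apply: cinfty_mx_add (cinfty_mx_cst _); apply: cinfty_mx_mul (cinfty_mx_AdG t).
by apply: cinfty_mx_mul (cinfty_mx_S s t); apply: cinfty_mx_tr; exact: cinfty_mx_AdG.
Qed.

Lemma der_mx_S s t f m : cinfty AM f ->
  der_mx (fun h => PM h f m) (S s t) =
  (Zm s)^T *m (\matrix_(i, j) PM (fun p => P p i j) f m)^rc *m Zm t.
Proof.
move=> Cf; have df := pb_derivation PM m Cf.
have C1 := cinfty_mx_mul (cinfty_mx_cst (A := AM) (Zm s)^T) cinfty_mx_PC.
rewrite /S (der_mx_add df (cinfty_mx_mul C1 (cinfty_mx_cst (Zm t))) (cinfty_mx_cst _)).
rewrite (der_mx_mul df C1 (cinfty_mx_cst _)) (der_mx_mul df (cinfty_mx_cst _) cinfty_mx_PC).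
rewrite !(der_mx_cst df) mul0mx mulmx0 add0r !addr0; congr (_ *m _ *m _).
apply/matrixP => i j; rewrite !mxE -(derC_real df).
by congr derC; apply/funext => p; rewrite mxE.
Qed.

(** The derivatives of the two [Adm] factors contribute the adjoint action on [S], and
    [jacobi_complex] contributes its negative. *)
Lemma der_mx_N s t f m : cinfty AM f -> der_mx (fun h => PM h f m) (N s t) = 0.
Proof.
move=> Cf; have df := pb_derivation PM m Cf.
have CA := cinfty_mx_AdG; have CS := cinfty_mx_S s t.
have CAt := cinfty_mx_tr (CA s).
rewrite /N (der_mx_add df (cinfty_mx_mul (cinfty_mx_mul CAt CS) (CA t)) (cinfty_mx_cst _)).
rewrite (der_mx_mul df (cinfty_mx_mul CAt CS) (CA t)) (der_mx_mul df CAt CS) der_mx_tr.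
rewrite (der_mx_cst df) addr0 !der_mx_AdG // der_mx_S // jacobi_complex //.
rewrite linear_sum /= mulmx_suml mulmx_sumr mulmxN mulmxDl mulNmx.
rewrite mulmx_sumr !mulmx_suml addrAC -big_split /=.
apply/eqP; rewrite subr_eq0; apply/eqP/eq_bigr => l _.
rewrite linearZ /= trmx_mul -!scalemxAr -!scalemxAl -scalerDr; congr (_ *: _).
by move: (S s t m) => T; rewrite mulmxDr mulmxDl !mulmxA.
Qed.

Lemma N_central s t i j :
  central PM (fun m => complex.Re (N s t m i j)) /\
  central PM (fun m => complex.Im (N s t m i j)).
Proof.
have [Cr Ci] := cinfty_mx_N s t i j.
split; split => // f Cf m;
  by have /matrixP/(_ i j) := der_mx_N s t m Cf; rewrite !mxE => /eqP;
     rewrite eq_complex /= => /andP[/eqP e1 /eqP e2].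
Qed.

Section Representation.
Variables (n : nat) (rho : K -> 'M[R[i]]_n).
Hypothesis hrho : rep AK rho.
Hypothesis drep_z : forall X, drep lam rho X = \sum_a z X 0 a *: drep lam rho (E a).

(** Left-invariant fields act on [rho] by multiplication on the right, which is why the tensor ends
    up on that side. *)
Lemma pb12_rho s t m :
  pb12 PM (fun m => rho (G s m)) (fun m => rho (G t m)) m =
  (rho (G s m) *t rho (G t m)) *m tensor (fun i => drep lam rho (E i)) (Pi s t m).
Proof.
have pbE i j u v : pbC PM (fun m => rho (G s m) i j) (fun m => rho (G t m) u v) m =
    \sum_a \sum_b (P m a b)%:C *
      ((rho (G s m) *m drep lam rho (x s a)) i j * (rho (G t m) *m drep lam rho (x t b)) u v).
  have [Cr Ci] := rep_cinftyC hrho i j; have [Cr' Ci'] := rep_cinftyC hrho u v.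
  have /= e1 := pb_pullbacks (sG t) (hG s) (PG t) m Cr Cr'.
  have /= e2 := pb_pullbacks (sG t) (hG s) (PG t) m Ci Ci'.
  have /= e3 := pb_pullbacks (sG t) (hG s) (PG t) m Cr Ci'.
  have /= e4 := pb_pullbacks (sG t) (hG s) (PG t) m Ci Cr'.
  rewrite /pbC /= e1 e2 e3 e4 -sumrB -big_split Complex_sum.
  apply: eq_bigr => a _; rewrite -sumrB -big_split Complex_sum; apply: eq_bigr => b _ /=.
  rewrite -!(derC_lfield_rep hlam hrho) /derC.
  apply/eqP; rewrite eq_complex /= !mul0r subr0 addr0.
  by apply/andP; split; apply/eqP; ring.
transitivity (\sum_a \sum_b (P m a b)%:C *:
   ((rho (G s m) *m drep lam rho (x s a)) *t (rho (G t m) *m drep lam rho (x t b)))).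
  rewrite /pb12.
  under eq_bigr => i _ do under eq_bigr => j _ do under eq_bigr => u _ do
    under eq_bigr => v _ do rewrite pbE.
  under [RHS]eq_bigr => a _ do under eq_bigr => b _ do rewrite tensmx_delta.
  symmetry.
  under eq_bigr => a _.
    under eq_bigr => b _.
      rewrite scaler_sumr; under eq_bigr => i _.
        rewrite scaler_sumr; under eq_bigr => j _.
          rewrite scaler_sumr; under eq_bigr => u _.
            rewrite scaler_sumr; under eq_bigr => v _ do rewrite scalerA.
            over.
          over.
        over.
      over.
    rewrite exchange_big /=.
    under eq_bigr => i _.
      rewrite exchange_big /=.
      under eq_bigr => j _.
        rewrite exchange_big /=.
        under eq_bigr => u _ do rewrite exchange_big /=.
        over.
      over.
    over.
  rewrite exchange_big /=; apply: eq_bigr => i _.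
  rewrite exchange_big /=; apply: eq_bigr => j _.
  rewrite exchange_big /=; apply: eq_bigr => u _.
  rewrite exchange_big /=; apply: eq_bigr => v _.
  rewrite scaler_suml; apply: eq_bigr => a _.
  by rewrite scaler_suml.
rewrite tensor_conj mulmx_sumr; apply: eq_bigr => a _.
rewrite mulmx_sumr; apply: eq_bigr => b _.
rewrite -tensmx_mul scalemxAr mxE; congr (_ *m (_ *: (_ *t _))).
  by rewrite drep_z; apply: eq_bigr => i _; rewrite mxE.
by rewrite drep_z; apply: eq_bigr => i _; rewrite mxE.
Qed.

(** With X the product of the two matrices, X Pi = X S - gamma X r. Moving [S] to the left through
    [drep_Ad] gives (N + gamma r) X - gamma X r. *)
Lemma exchange_relation s t m :
  pb12 PM (fun m => rho (G s m)) (fun m => rho (G t m)) m =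
    gam%:C *: commx (tensor (fun i => drep lam rho (E i)) (r s t))
        (leg1 (rho (G s m)) *m leg2 (rho (G t m)))
    + tensor (fun i => drep lam rho (E i)) (N s t m) *m leg1 (rho (G s m)) *m leg2 (rho (G t m)).
Proof.
rewrite pb12_rho -mulmxA leg12.
set X := _ *t _; set TE := tensor _.
have conj T : TE ((Adm (G s m))^T *m T *m Adm (G t m)) *m X = X *m TE T.
  rewrite /TE tensor_conj mulmx_suml mulmx_sumr; apply: eq_bigr => a _.
  rewrite mulmx_suml mulmx_sumr; apply: eq_bigr => b _.
  rewrite -scalemxAl -scalemxAr; congr (_ *: _).
  have AE u c : \sum_i Adm (G u m) c i *: drep lam rho (E i) =
      drep lam rho (Ad hK hlam (G u m) (E c)).
    by rewrite [RHS]drep_z; apply: eq_bigr => i _; rewrite mxE.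
  by rewrite !AE /X !tensmx_mul -!drep_Ad.
have TD T1 T2 : TE (T1 + T2) = TE T1 + TE T2 by exact: tensorD.
have TN T1 : TE (- T1) = - TE T1 by exact: tensorN.
have TZ c T1 : TE (c *: T1) = c *: TE T1 by exact: tensorZ.
rewrite /N TD TN mulmxBl conj /S TD TZ mulmxDr /commx.
rewrite scalerBr -scalemxAl -scalemxAr.
by rewrite [RHS]addrC -[RHS]addrA addKr addrK.
Qed.

End Representation.

(** The last clause serves the split case, where N must lie in the real tensor square although it is
    computed with complex matrices. *)
Lemma exchange_relations_exist : exists N : bool -> bool -> M -> 'M[R[i]]_d,
  [/\ forall s t i j, central PM (fun m => complex.Re (N s t m i j)) /\
                      central PM (fun m => complex.Im (N s t m i j)),
      forall n (rho : K -> 'M[R[i]]_n), rep AK rho ->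
        (forall X, drep lam rho X = \sum_a z X 0 a *: drep lam rho (E a)) ->
        forall s t m,
        pb12 PM (fun m => rho (G s m)) (fun m => rho (G t m)) m =
          gam%:C *: commx (tensor (fun i => drep lam rho (E i)) (r s t))
            (leg1 (rho (G s m)) *m leg2 (rho (G t m)))
          + tensor (fun i => drep lam rho (E i)) (N s t m)
              *m leg1 (rho (G s m)) *m leg2 (rho (G t m)) &
      (forall X p, complex.Im (z X 0 p) = 0) ->
        (forall s t i j, complex.Im (r s t i j) = 0) ->
        forall s t m i j, complex.Im (N s t m i j) = 0].
Proof.
exists N; split; [exact: N_central|by move=> *; exact: exchange_relation|].
move=> zR rR s t m i j.
have sumR I (s0 : seq I) (F : I -> R[i]) : (forall i, complex.Im (F i) = 0) ->
    complex.Im (\sum_(i <- s0) F i) = 0.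
  move=> H; elim: s0 => [|c s0 IH]; first by rewrite big_nil.
  by rewrite big_cons complexImD H IH addr0.
have mulR (a b : R[i]) : complex.Im a = 0 -> complex.Im b = 0 -> complex.Im (a * b) = 0.
  by move=> a0 b0; rewrite complexImM a0 b0 mulr0 mul0r addr0.
have mxR a b c (X : 'M[R[i]]_(a, b)) (Y : 'M[R[i]]_(b, c)) :
    (forall i j, complex.Im (X i j) = 0) -> (forall i j, complex.Im (Y i j) = 0) ->
    forall i j, complex.Im ((X *m Y) i j) = 0.
  by move=> X0 Y0 u v; rewrite mxE; apply: sumR => w; exact: mulR.
have rgR u v : complex.Im ((gam%:C *: r s t) u v) = 0 by rewrite mxE; exact: mulR.
have AR y u v : complex.Im (Adm y u v) = 0 by rewrite mxE.
have ZR y u v : complex.Im (Zm y u v) = 0 by rewrite mxE.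
rewrite /N mxE complexImD [X in _ + complex.Im X]mxE.
have -> : complex.Im (- (gam%:C *: r s t) i j) = 0.
  by move: (rgR i j); case: (_ i j) => u v /= ->; rewrite oppr0.
rewrite addr0; apply: (mxR) => //; apply: (mxR) => [u v|u v]; first by rewrite mxE.
rewrite /S mxE complexImD rgR addr0 /Pi.
apply: (mxR) => //; apply: (mxR) => [u' v'|u' v']; first by rewrite mxE.
by rewrite mxE.
Qed.

End Exchange.

(** * The Killing form, the Casimir and the modified Yang-Baxter equation *)

(** On smooth functions the bracket is a commutator of iterated derivatives, hence skew, and [lam]
    separates vectors. *)
Lemma lie_algebra_skew (R : realType) (K : topGroupType) (AK : smoothStructure R K)
    (k : vectType R) (brk : k -> k -> k) (lam : k -> (K -> R) -> R) :
  lie_algebra_of AK brk lam -> forall X Y, brk X Y = - brk Y X.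
Proof.
move=> hlam X Y; apply: (lam_inj hlam) => h Ch.
have := lam_linear hlam (-1) (brk Y X) 0 Ch; rewrite scaleN1r addr0 (lam0 hlam) // addr0 => ->.
case: hlam => _ _ _ _ H; rewrite !H //; ring.
Qed.

Section KillingForm.
Context {R : realType} {g : vectType R}.
Variable br : g -> g -> g.
Hypothesis hbr : lie_bracket br.
(* lie_bracket asks for linearity in the second argument only, which does not give this. *)
Hypothesis br_skew : forall X Y, br X Y = - br Y X.

Local Notation d := (\dim {:g}).
Local Notation e := (@bas R g).
Local Notation co := (coord (vbasis {:g})).

Lemma coord_bas i j : co j (e i) = (i == j)%:R.
Proof. by rewrite /bas coord_free ?(basis_free (vbasisP _)) // eq_sym. Qed.

Lemma bas_expand X : X = \sum_i co i X *: e i.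
Proof. by rewrite {1}(coord_vbasis (memvf X)). Qed.

Lemma br_linear X : linear (br X). Proof. by case: hbr. Qed.

HB.instance Definition _ X := GRing.isLinear.Build R g g *:%R (br X) (br_linear X).

(** Row [i] holds the coordinates of the image of [e i]: operators act on row vectors, and matrix
    products reverse composition. *)
Definition ad_mx X : 'M[R]_d := \matrix_(i, j) co j (br X (e i)).
Definition gram : 'M[R]_d := \matrix_(i, j) killing br (e i) (e j).
Definition op_mx (A : 'End(g)) : 'M[R]_d := \matrix_(i, j) co j (A (e i)).

Lemma coord_sum_mx (L : {linear g -> g}) Y j :
  co j (L Y) = \sum_i co i Y * co j (L (e i)).
Proof.
rewrite {1}(bas_expand Y) !linear_sum; apply: eq_bigr => i _.
by rewrite !linearZ.
Qed.

Lemma ad_mx_lin r X Y : ad_mx (r *: X + Y) = r *: ad_mx X + ad_mx Y.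
Proof.
apply/matrixP => i j; rewrite !mxE br_skew linearP -scaleN1r scalerDr !scaleN1r.
by rewrite -scalerN -!br_skew linearP.
Qed.

Lemma ad_mxZ c X : ad_mx (c *: X) = c *: ad_mx X.
Proof.
have ad0 : ad_mx 0 = 0 by apply/matrixP => i j; rewrite !mxE br_skew linear0 oppr0 linear0.
by have := ad_mx_lin c X 0; rewrite ad0 !addr0.
Qed.

Lemma ad_mx_comb c u X Y : ad_mx (c *: (X + u *: Y)) = c *: (ad_mx X + u *: ad_mx Y).
Proof. by rewrite ad_mxZ addrC ad_mx_lin addrC. Qed.

(** Symmetry and invariance of the Killing form then follow from cyclicity of the trace. *)
Lemma killing_trace X Y : killing br X Y = \tr (ad_mx Y *m ad_mx X).
Proof.
rewrite /killing /mxtrace; apply: eq_bigr => i _; rewrite mxE (coord_sum_mx (br X)).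
by apply: eq_bigr => j _; rewrite !mxE.
Qed.

Lemma killing_sym X Y : killing br X Y = killing br Y X.
Proof. by rewrite !killing_trace mxtrace_mulC. Qed.

Lemma killing_linear X : linear (killing br X : g -> R^o).
Proof.
move=> r Y Z; rewrite !killing_trace ad_mx_lin mulmxDl -scalemxAl linearD linearZ //.
Qed.

HB.instance Definition _ X := GRing.isLinear.Build R g R^o *:%R (killing br X) (killing_linear X).

Lemma ad_mx_br X Y : ad_mx (br X Y) = ad_mx Y *m ad_mx X - ad_mx X *m ad_mx Y.
Proof.
apply/matrixP => i j; rewrite !mxE.
have -> : br (br X Y) (e i) = br X (br Y (e i)) - br Y (br X (e i)).
  case: hbr => _ _ /(_ X Y (e i)); rewrite (br_skew (e i) (br X Y)) (br_skew (e i) X).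
  by rewrite linearN => /eqP; rewrite subr_eq0 => /eqP <-.
rewrite linearB /= (coord_sum_mx (br X)) (coord_sum_mx (br Y)); congr (_ - _);
by apply: eq_bigr => l _; rewrite !mxE.
Qed.

Lemma killing_invariant X Y Z : killing br (br X Y) Z = - killing br Y (br X Z).
Proof.
have trB (U V : 'M[R]_d) : \tr (U - V) = \tr U - \tr V by exact: raddfB.
rewrite !killing_trace !ad_mx_br mulmxBr mulmxBl !trB opprB !mulmxA.
by rewrite [\tr (_ *m ad_mx X)]mxtrace_mulC mulmxA.
Qed.

Lemma kappa_dualE X Y : kappa_dual br X Y = killing br X Y.
Proof. by rewrite /kappa_dual lfunE. Qed.

Lemma killing_sumr (I : Type) (s : seq I) (c : I -> R) (F : I -> g) X :
  killing br X (\sum_(i <- s) c i *: F i) = \sum_(i <- s) c i * killing br X (F i).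
Proof. by rewrite linear_sum; apply: eq_bigr => i _; rewrite linearZ. Qed.

Lemma killing0r X : killing br X 0 = 0.
Proof. exact: linear0. Qed.

Section Casimir.
Variables (Rop : 'End(g)) (R12 C12 : 'M[R]_d).
Hypothesis hskew : skew_symmetric br Rop.
Hypothesis hR12 : kernel_of br Rop R12.
Hypothesis hC12 : kernel_of br \1%VF C12.

Lemma coord_casimir i Y : co i Y = \sum_j C12 i j * killing br (e j) Y.
Proof.
have := hC12 Y; rewrite id_lfunE => {1}->; rewrite linear_sum (bigD1 i) //= [X in _ + X]big1 ?addr0.
  rewrite linear_sum; apply: eq_bigr => j _; rewrite linearZ /= coord_bas eqxx.
  by rewrite mulr1.
move=> l li; rewrite linear_sum big1 // => j _.
by rewrite linearZ /= coord_bas (negbTE li) mulr0.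
Qed.

(** [hC12] expresses every vector through its pairings with the basis, so [C12] is the inverse of
    the Gram matrix and kappa is nondegenerate. *)
Lemma casimir_gram : C12 *m gram = 1%:M.
Proof.
apply/matrixP => i k; rewrite [LHS]mxE [RHS]mxE eq_sym -(coord_bas k i) coord_casimir.
by apply: eq_bigr => j _; rewrite mxE.
Qed.

Lemma gram_casimir : gram *m C12 = 1%:M. Proof. exact: mulmx1C casimir_gram. Qed.

Lemma gram_sym : gram^T = gram.
Proof. by apply/matrixP => i j; rewrite !mxE killing_sym. Qed.

Lemma casimir_sym : C12^T = C12.
Proof.
have : C12^T *m gram = 1%:M by rewrite -{1}gram_sym -trmx_mul gram_casimir trmx1.
move=> /(congr1 (fun X => X *m C12)).
by rewrite -mulmxA gram_casimir mulmx1 mul1mx.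
Qed.

(** The premise is skewness of [X] for kappa; multiplying by the inverse Gram matrix on both sides
    transfers it to the Casimir. *)
Lemma casimir_anti (X : 'M[R]_d) : X *m gram = - (gram *m X^T) -> C12 *m X = - (X^T *m C12).
Proof.
move=> /(congr1 (fun Y => C12 *m Y *m C12)).
rewrite mulmxN mulNmx !mulmxA casimir_gram mul1mx -!mulmxA gram_casimir mulmx1 => ->.
by [].
Qed.

Lemma casimir_ad X : C12 *m ad_mx X = - ((ad_mx X)^T *m C12).
Proof.
apply: casimir_anti; apply/matrixP => i j; rewrite !mxE.
have -> : \sum_l ad_mx X i l * gram l j = killing br (br X (e i)) (e j).
  rewrite killing_sym {1}(bas_expand (br X (e i))) linear_sum; apply: eq_bigr => l _.
  by rewrite linearZ !mxE killing_sym.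
rewrite killing_invariant; congr (- _); rewrite {1}(bas_expand (br X (e j))) linear_sum.
by apply: eq_bigr => l _; rewrite linearZ !mxE mulrC.
Qed.

Lemma casimir_op : C12 *m op_mx Rop = - ((op_mx Rop)^T *m C12).
Proof.
apply: casimir_anti; apply/matrixP => i j; rewrite !mxE.
have -> : \sum_l op_mx Rop i l * gram l j = killing br (Rop (e i)) (e j).
  rewrite killing_sym {1}(bas_expand (Rop (e i))) linear_sum; apply: eq_bigr => l _.
  by rewrite linearZ !mxE killing_sym.
rewrite hskew; congr (- _); rewrite {1}(bas_expand (Rop (e j))) linear_sum.
by apply: eq_bigr => l _; rewrite linearZ !mxE mulrC.
Qed.

Lemma R12_casimir : R12 = (op_mx Rop)^T *m C12.
Proof.
suff -> : (op_mx Rop)^T = R12 *m gram by rewrite -mulmxA gram_casimir mulmx1.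
apply/matrixP => i k; rewrite !mxE hR12 linear_sum (bigD1 i) //= [X in _ + X]big1 ?addr0.
  rewrite linear_sum; apply: eq_bigr => j _; rewrite linearZ /= coord_bas eqxx mxE.
  by rewrite mulr1.
move=> l li; rewrite linear_sum big1 // => j _.
by rewrite linearZ /= coord_bas (negbTE li) mulr0.
Qed.

Lemma mCYBE_mx c2 X : mCYBE br c2 Rop ->
  op_mx Rop *m ad_mx (Rop X) - (ad_mx (Rop X) *m op_mx Rop
    + op_mx Rop *m ad_mx X *m op_mx Rop) = - (c2 *: ad_mx X).
Proof.
move=> H; apply/matrixP => i j; have := congr1 (co j) (H X (e i)).
rewrite !mxE linearB linearN linearZ /= linearD linearD /= => <-.
congr (_ - (_ + _)).
- by rewrite (coord_sum_mx (br (Rop X))); apply: eq_bigr => l _; rewrite !mxE.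
- by rewrite (coord_sum_mx Rop); apply: eq_bigr => l _; rewrite !mxE.
- rewrite (coord_sum_mx Rop); apply: eq_bigr => l _; rewrite !mxE; congr (_ * _).
  by rewrite (coord_sum_mx (br X)); apply: eq_bigr => n _; rewrite !mxE.
Qed.

Definition dual_bas i : g := \sum_a C12 i a *: e a.

Lemma killing_dual_bas i Y : killing br (dual_bas i) Y = co i Y.
Proof.
rewrite killing_sym linear_sum coord_casimir; apply: eq_bigr => j _.
by rewrite linearZ /= killing_sym.
Qed.

Lemma dual_bas_expand X : X = \sum_i killing br X (e i) *: dual_bas i.
Proof.
transitivity (\sum_a (\sum_i killing br X (e i) * C12 i a) *: e a).
  rewrite {1}(bas_expand X); apply: eq_bigr => a _; congr (_ *: _).
  rewrite coord_casimir; apply: eq_bigr => i _; rewrite killing_sym mulrC.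
  by rewrite -{1}casimir_sym mxE.
under eq_bigr do rewrite scaler_suml; rewrite exchange_big; apply: eq_bigr => i _.
by rewrite /dual_bas scaler_sumr; apply: eq_bigr => a _; rewrite scalerA.
Qed.

(** The structure constants of the dual basis, and so of the fields [D i], in the factored form that
    the Yang-Baxter identity can absorb. *)
Lemma killing_dual_bracket l i j :
  killing br (br (dual_bas i) (dual_bas j)) (e l) = (C12 *m ad_mx (e l)) i j.
Proof.
rewrite br_skew killing_sym linearN /= -killing_sym killing_invariant opprK.
rewrite killing_dual_bas br_skew linearN /= linear_sum linear_sum /=.
have -> : \sum_a co i (br (e l) (C12 j a *: e a)) = (C12 *m ad_mx (e l)) j i.
  by rewrite mxE; apply: eq_bigr => a _; rewrite !linearZ mxE.
rewrite [in RHS]casimir_ad [RHS]mxE; congr (- _); rewrite !mxE; apply: eq_bigr => a _.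
by rewrite mulrC -{1}casimir_sym !mxE.
Qed.

End Casimir.
End KillingForm.

(** The left side is the action of R + s c and R + t c on the two legs of [r]. Transposes are moved
    across [C12] by skewness, [C12] is cancelled on the left, and the mCYBE disposes of the product
    [Rm *m a']. *)
Lemma yang_baxter_matrix (R : realType) (d : nat) (c : R[i]) (c2 : R)
    (Rm a a' C12 R12 : 'M[R]_d) (s t : bool) :
  c * c = real_complex R c2 ->
  C12 *m a = - (a^T *m C12) -> C12 *m a' = - (a'^T *m C12) ->
  C12 *m Rm = - (Rm^T *m C12) -> R12 = Rm^T *m C12 ->
  Rm *m a' - (a' *m Rm + Rm *m a *m Rm) = - (c2 *: a) ->
  let cx := @map_mx _ _ (real_complex R) d d in
  let r := if s == t then cx R12 else cx R12 + (sgn s * c) *: cx C12 in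
  (cx a' + (sgn s * c) *: cx a)^T *m r + r *m (cx a' + (sgn t * c) *: cx a) =
  (cx Rm + (sgn s * c) *: 1%:M)^T *m cx (C12 *m a) *m (cx Rm + (sgn t * c) *: 1%:M).
Proof.
move=> hc ha ha' hR eR12 hY cx r.
pose de : R[i] := if s == t then 0 else sgn s * c.
have anti X : C12 *m X = - (X^T *m C12) -> (cx X)^T *m cx C12 = - (cx C12 *m cx X).
  by move=> H; rewrite /cx map_trmx -!map_mxM H map_mxN opprK.
have er : r = cx C12 *m (de *: 1%:M - cx Rm).
  rewrite mulmxBr -scalemxAr mulmx1 -(anti Rm hR) /cx map_trmx -map_mxM -eR12 /r /de.
  by case: ifP => _; [rewrite scale0r add0r|rewrite addrC].
set es := sgn s * c; set et := sgn t * c.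
have e1 : (cx a' + es *: cx a)^T *m cx C12 = - (cx C12 *m (cx a' + es *: cx a)).
  rewrite linearD linearZ /= mulmxDl -scalemxAl !anti // mulmxDr -scalemxAr.
  by rewrite scalerN opprD.
have e2 : (cx Rm + es *: 1%:M)^T *m cx C12 = cx C12 *m (es *: 1%:M - cx Rm).
  rewrite linearD linearZ /= trmx1 mulmxDl -scalemxAl mul1mx anti // mulmxBr -scalemxAr.
  by rewrite mulmx1 addrC.
(* The coefficient left in front of [a]. For opposite signs it forces [de = es], the Casimir shift
   in [r]; for equal signs [et - es] vanishes and the value 0 is taken. *)
have hde : c * c + de * (et - es) = es * et.
  suff H u v : c * c + (if u == v then 0 else sgn u * c) * (sgn v * c - sgn u * c)
      = sgn u * c * (sgn v * c) by exact: H.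
  by case: u; case: v; rewrite /sgn /=; ring.
have cxM : cx (C12 *m a) = cx C12 *m cx a by exact: map_mxM.
rewrite er !mulmxA e1 cxM mulmxA e2 -!mulmxA mulNmx -!mulmxA -mulmxN -mulmxDr.
congr (_ *m _).
have hY' : cx Rm *m cx a' = cx a' *m cx Rm + cx Rm *m (cx a *m cx Rm) - (c * c) *: cx a.
  rewrite hc /cx -map_mxZ -!map_mxM -map_mxD -map_mxB; congr map_mx.
  by move/eqP: hY; rewrite subr_eq => /eqP ->; rewrite mulmxA addrC.
move: (cx a) (cx a') (cx Rm) hY' => A A' X hY'.
have -> : (A' + es *: A) *m (de *: 1%:M - X) =
    de *: A' - A' *m X + (es * de) *: A - es *: (A *m X).
  rewrite mulmxDl -scalemxAl !mulmxBr -!scalemxAr !mulmx1 scalerBr scalerA.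
  by rewrite !addrA.
have -> : (de *: 1%:M - X) *m (A' + et *: A) =
    de *: A' + (de * et) *: A - X *m A' - et *: (X *m A).
  rewrite mulmxBl -!scalemxAl !mul1mx mulmxDr -scalemxAr scalerDr scalerA.
  by rewrite opprD !addrA.
have -> : (es *: 1%:M - X) *m (A *m (X + et *: 1%:M)) =
    es *: (A *m X) + (es * et) *: A - X *m (A *m X) - et *: (X *m A).
  rewrite mulmxBl -!scalemxAl !mul1mx !mulmxDr -!scalemxAr mulmx1 scalerDr scalerA.
  by rewrite opprD !addrA.
rewrite hY' -hde; apply/matrixP => i j; rewrite !mxE.
ring.
Qed.

(** * The infinitesimal action *)

Section InfinitesimalAction.
Context {R : realType}.
Variables (g : vectType R) (br : g -> g -> g).
Hypothesis hbr : lie_bracket br.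
Variables (G : topGroupType) (AG : smoothStructure R G).
Variable lam : g -> (G -> R) -> R.
Hypothesis hG : lie_group AG.
Hypothesis hlam : lie_algebra_of AG br lam.
Variables (M : topologicalType) (AM : smoothStructure R M).
Variables (is_left : bool) (act : G -> M -> M).
Hypothesis sact : smooth_map (prod_atlas (atlas AG) (atlas AM)) (atlas AM)
        (fun p : G * M => act p.1 p.2).
Hypothesis actM : forall x y m, act (x * y)%g m =
        if is_left then act x (act y m) else act y (act x m).

Local Notation delta := (inf_action lam is_left act).

(** Inverting the group element turns a left action into a right one, so both cases follow the rule
    [ractM]. *)
Let ract x m := act (if is_left then x^-1%g else x) m.

Lemma ractM x y m : ract y (ract x m) = ract (x * y)%g m.
Proof.
rewrite /ract; move: actM; case: is_left => H; last by rewrite H.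
by rewrite invgM H.
Qed.

Lemma cinfty_ract f m : cinfty AM f -> cinfty AG (fun x => f (ract x m)).
Proof.
move=> Cf; have C1 := cinfty_comp (smooth_map_section1 sact m) Cf.
by rewrite /ract; case: is_left => //; exact: (cinfty_comp hG.2 C1).
Qed.

Lemma cinfty_inf_action X f : cinfty AM f -> cinfty AM (delta X f).
Proof.
move=> Cf; have := cinfty_tangent1 sact; rewrite /inf_action; case: is_left => H.
  (* The inversion is absorbed into the tangent vector, so that only the smooth map [act] is
     differentiated. *)
  have [W HW] := inv_push hG hlam X.
  rewrite (_ : (fun m => _) = fun m => lam W (fun x => f (act x m))).
    exact: (H _ _ _ (lam_tangent hlam W) Cf).
  apply/funext => m; rewrite -HW //.
  exact: cinfty_comp (smooth_map_section1 sact m) Cf.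
exact: (H _ _ _ (lam_tangent hlam X) Cf).
Qed.

Lemma inf_action_sum (I : Type) (s : seq I) (c : I -> R) (F : I -> g) f m : cinfty AM f ->
  delta (\sum_(i <- s) c i *: F i) f m = \sum_(i <- s) c i * delta (F i) f m.
Proof. by move=> Cf; rewrite /inf_action (lam_sum hlam) //; exact: cinfty_ract. Qed.

Lemma inf_actionN X f m : cinfty AM f -> delta X (fun p => - f p) m = - delta X f m.
Proof.
by move=> Cf; apply: (derivationN (lam_derivation hlam X)); exact: (cinfty_ract m Cf).
Qed.

(** On the function [x |-> f (ract x m)] the iterated actions are the iterated derivatives of
    [x * y], whose commutator defines [br]. *)
Lemma inf_action_bracket X Y f m : cinfty AM f ->
  delta X (delta Y f) m - delta Y (delta X f) m = delta (br X Y) f m.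
Proof.
move=> Cf; case: hlam => _ _ _ _ H; rewrite /inf_action H; last exact: (cinfty_ract m Cf).
by congr (_ - _); congr lam; apply/funext => x; congr lam; apply/funext => y;
  rewrite -/(ract _ _) -/(ract y _) ractM.
Qed.

Section DualBasis.
Variable C12 : 'M[R]_(\dim {:g}).
Hypothesis hC12 : kernel_of br \1%VF C12.

Definition dual_action i f m := - delta (dual_bas C12 i) f m.

Lemma cinfty_dual_action i f : cinfty AM f -> cinfty AM (dual_action i f).
Proof. by move=> Cf; apply: cinftyN; exact: cinfty_inf_action. Qed.

Lemma inf_action_dual X f m : cinfty AM f ->
  delta X f m = - \sum_l killing br X (bas l) * dual_action l f m.
Proof.
move=> Cf; have sk := lie_algebra_skew hlam.
rewrite {1}(dual_bas_expand hbr hC12 X) inf_action_sum // -sumrN.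
by apply: eq_bigr => i _; rewrite /dual_action mulrN opprK.
Qed.

Lemma dual_action_comm i j f m : cinfty AM f ->
  dual_action i (dual_action j f) m - dual_action j (dual_action i f) m =
  \sum_l dual_action l f m * - (C12 *m ad_mx br (bas l)) i j.
Proof.
move=> Cf; have sk := lie_algebra_skew hlam.
have DD a b : dual_action a (dual_action b f) m =
    delta (dual_bas C12 a) (delta (dual_bas C12 b) f) m.
  have /= := inf_actionN (dual_bas C12 a) m (cinfty_inf_action (dual_bas C12 b) Cf).
  by rewrite {1}/dual_action => ->; rewrite opprK.
rewrite !DD inf_action_bracket // inf_action_dual // -sumrN.
by apply: eq_bigr => l _; rewrite (killing_dual_bracket hbr sk hC12) mulrC mulrN.
Qed.

Lemma left_log_sum (PM : poisson AM) (K : topGroupType) (AK : smoothStructure R K)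
    (k : vectType R) (brk : k -> k -> k) (lamK : k -> (K -> R) -> R)
    (x : 'I_(\dim {:g}) -> k) (F : M -> K) f m :
  lie_group AK -> lie_algebra_of AK brk lamK ->
  log_derivative PM dual_action AK lamK x F -> cinfty AM f ->
  left_log PM AK lamK F f m (\sum_i dual_action i f m *: x i).
Proof.
move=> hK hlamK hF Cf h Ch; rewrite (lam_sum hlamK) //.
rewrite (hF (fun y => h ((F m)^-1 * y)%g)) //; last exact: cinfty_mull.
apply: eq_bigr => i _; rewrite /lfield; congr (_ * lamK _ _).
by apply/funext => y; rewrite mulKg.
Qed.

(** The moment map property prescribes [eta] on every vector; its values on the dual basis are its
    coefficients along the forms kappa(e_i, .). *)
Lemma moment_map_log_derivative (PM : poisson AM) (Gs : topGroupType)
    (AGs : smoothStructure R Gs) (brs : 'Hom(g, R^o) -> 'Hom(g, R^o) -> 'Hom(g, R^o))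
    (lams : 'Hom(g, R^o) -> (Gs -> R) -> R) (Gam : M -> Gs) :
  lie_group AGs -> lie_algebra_of AGs brs lams ->
  moment_map PM AGs lams delta Gam ->
  log_derivative PM dual_action AGs lams (fun i => kappa_dual br (bas i)) Gam.
Proof.
move=> hGs hlams [sGam HGam] a f m Ca Cf; have sk := lie_algebra_skew hlam.
have [eta log_eta eta_delta] := HGam f Cf m.
have := log_eta _ (cinfty_mull hGs (Gam m) Ca).
have -> : (fun p => a (Gam m * ((Gam m)^-1 * Gam p))%g) = fun p => a (Gam p).
  by apply/funext => p; rewrite mulVKg.
move=> <-; have -> : eta = \sum_i dual_action i f m *: kappa_dual br (bas i).
  apply/lfunP => Y; rewrite sum_lfunE {1}(dual_bas_expand hbr hC12 Y) linear_sum.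
  apply: eq_bigr => i _; rewrite linearZ scale_lfunE (kappa_dualE hbr sk).
  rewrite /dual_action eta_delta opprK.
  by rewrite /GRing.scale /= mulrC (killing_sym hbr).
by rewrite (lam_sum hlams) //; exact: cinfty_mull.
Qed.

End DualBasis.
End InfinitesimalAction.

(** * Real and complex coordinates along a basis of g *)

Section Coordinates.
Context {R : realType} {g : vectType R}.
Local Notation d := (\dim {:g}).
Local Notation co := (coord (vbasis {:g})).

Lemma real_expand (V : lmodType R[i]) (F : g -> V) X :
  (forall r X Y, F (r *: X + Y) = real_complex R r *: F X + F Y) ->
  F X = \sum_a real_complex R (co a X) *: F (bas a).
Proof.
move=> linF; have F0 : F 0 = 0.
  have := linF 1 0 0; rewrite scaler0 addr0 rmorph1 scale1r => /eqP.
  by rewrite -subr_eq0 opprD addrA subrr sub0r oppr_eq0 => /eqP.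
rewrite {1}(bas_expand X); elim: (index_enum _) => [|a s IH]; first by rewrite !big_nil F0.
by rewrite !big_cons linF IH.
Qed.

(** Real linearity together with compatibility with [timesI] is complex linearity, so the values on
    [(bas a, 0)] determine [F]. *)
Lemma complex_expand (V : lmodType R[i]) (F : g * g -> V) Z :
  (forall r X Y, F (r *: X + Y) = real_complex R r *: F X + F Y) ->
  (forall X, F (timesI X) = Complex 0 1 *: F X) ->
  F Z = \sum_a Complex (co a Z.1) (co a Z.2) *: F (bas a, 0).
Proof.
move=> linF FI; pose F1 X := F (X, 0).
have linF1 r X Y : F1 (r *: X + Y) = real_complex R r *: F1 X + F1 Y.
  by rewrite /F1 -linF; congr F; congr pair; rewrite /= scaler0 addr0.
have -> : F Z = F1 Z.1 + Complex 0 1 *: F1 Z.2.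
  rewrite -FI /F1 -[F (Z.1, 0)]scale1r -(rmorph1 (real_complex R)) -linF; congr F.
  rewrite scale1r /timesI; case: Z => A B /=; congr pair; rewrite /=.
    by rewrite oppr0 addr0.
  by rewrite add0r.
rewrite !(real_expand _ linF1) scaler_sumr -big_split; apply: eq_bigr => a _ /=.
rewrite scalerA -scalerDl; congr (_ *: _).
by apply/eqP; rewrite eq_complex /= !mul0r !mul1r !subr0 !addr0 !add0r !eqxx.
Qed.

Definition real_coords (X : g) : 'rV[R[i]]_d := \row_p real_complex R (co p X).
Definition complex_coords (Z : g * g) : 'rV[R[i]]_d := \row_p Complex (co p Z.1) (co p Z.2).

Lemma real_coords_linear r X Y :
  real_coords (r *: X + Y) = real_complex R r *: real_coords X + real_coords Y.
Proof. by apply/rowP => p; rewrite !mxE linearP /= rmorphD rmorphM. Qed.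

Lemma complex_coords_linear r X Y :
  complex_coords (r *: X + Y) = real_complex R r *: complex_coords X + complex_coords Y.
Proof.
apply/rowP => p; rewrite !mxE !linearP /=; apply/eqP.
by rewrite eq_complex /= !mul0r subr0 addr0 !eqxx.
Qed.

Lemma complex_coords_timesI Z : complex_coords (timesI Z) = Complex 0 1 *: complex_coords Z.
Proof.
apply/rowP => p; rewrite !mxE /= linearN; apply/eqP.
by rewrite eq_complex /= !mul0r !mul1r sub0r add0r !eqxx.
Qed.

Lemma real_coords_map (L : g -> g) X :
  (forall r X Y, L (r *: X + Y) = r *: L X + L Y) ->
  real_coords (L X) = real_coords X *m \matrix_(a, p) real_coords (L (bas a)) 0 p.
Proof.
move=> linL; rewrite (real_expand (F := fun X => real_coords (L X)) X); last first.
  by move=> r Y Z; rewrite linL real_coords_linear.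
rewrite mulmx_sum_row; apply: eq_bigr => a _; rewrite mxE; congr (_ *: _).
by apply/rowP => p; rewrite !mxE.
Qed.

Lemma complex_coords_map (L : g * g -> g * g) Z :
  (forall r X Y, L (r *: X + Y) = r *: L X + L Y) ->
  (forall X, L (timesI X) = timesI (L X)) ->
  complex_coords (L Z) =
  complex_coords Z *m \matrix_(a, p) complex_coords (L (bas a, 0)) 0 p.
Proof.
move=> linL LI; rewrite (complex_expand (F := fun X => complex_coords (L X)) Z); last 2 first.
- by move=> r Y W; rewrite linL complex_coords_linear.
- by move=> Y; rewrite LI complex_coords_timesI.
rewrite mulmx_sum_row; apply: eq_bigr => a _; rewrite [complex_coords Z _ _]mxE; congr (_ *: _).
by apply/rowP => p; rewrite !mxE.
Qed.

End Coordinates.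

(** Both sides are quadratic in [gam]: one factor from the generator acting and one in front on the
    left, one from each of [W] and [W'] on the right. *)
Lemma scaled_identity (R : realType) (d : nat) (gam : R[i]) (U V r W W' Q : 'M[R[i]]_d) :
  U^T *m r + r *m V = W^T *m Q *m W' ->
  gam *: ((gam *: U)^T *m r + r *m (gam *: V)) = (gam *: W)^T *m Q *m (gam *: W').
Proof.
by move=> H; rewrite !linearZ /= -!scalemxAl -scalerDr H.
Qed.

(** * The split and non-split cases *)

Theorem mainTheorem7 (R : realType)
  (* the Lie algebra, R and the kernels R_12, C_12 *)
  (g : vectType R) (br : g -> g -> g)
  (hbr : lie_bracket br) (hss : semisimple br)
  (Rop : 'End(g)) (hskew : skew_symmetric br Rop)
  (R12 C12 : 'M[R]_(\dim {:g}))
  (hR12 : kernel_of br Rop R12) (hC12 : kernel_of br \1%VF C12)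
  (gam : R) (hgam : gam != 0)
  (* the Lie group G with the Sklyanin bracket *)
  (G : topGroupType) (AG : smoothStructure R G) (hG : lie_group AG)
  (lam : g -> (G -> R) -> R) (hlam : lie_algebra_of AG br lam)
  (PG : poisson AG) (hPG : sklyanin PG lam gam R12)
  (* the dual group G^* *)
  (brs : 'Hom(g, R^o) -> 'Hom(g, R^o) -> 'Hom(g, R^o))
  (hbrs : dual_bracket PG lam brs)
  (Gs : topGroupType) (AGs : smoothStructure R Gs) (hGs : lie_group AGs)
  (hsc : @simply_connected R Gs)
  (lams : 'Hom(g, R^o) -> (Gs -> R) -> R)
  (hlams : lie_algebra_of AGs brs lams)
  (* the Poisson-Lie action on M and its moment map *)
  (M : topologicalType) (AM : smoothStructure R M) (PM : poisson AM)
  (is_left : bool) (act : G -> M -> M)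
  (hact : poisson_lie_action PG PM is_left act)
  (Gam : M -> Gs)
  (hGam : moment_map PM AGs lams (inf_action lam is_left act) Gam) :
  (* c = 1; (Phi true, Phi false) lifts Delta o pi^-1, its image is G_DR *)
  (mCYBE br 1 Rop ->
   forall Phi : bool -> Gs -> G,
   (forall s, lie_group_hom AGs AG (Phi s)) ->
   (forall s X h, cinfty AG h ->
      lams (kappa_dual br X) (h \o Phi s) =
      lam (gam *: (Rop X + sgn s *: X)) h) ->
   (exists2 N : bool -> bool -> M -> 'M[R]_(\dim {:g}),
      forall s t i j, central PM (fun m => N s t m i j) &
      forall n (rho : G -> 'M[R[i]]_n), rep AG rho ->
        exchange_relations PM 1 gam R12 C12
          (fun i => drep lam rho (bas i))
          (fun s m => rho (Phi s (Gam m)))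
          (fun s t m => complexify (N s t m)))
   /\
   (forall eps f m, cinfty AM f ->
      exists2 X : bool -> g,
        forall s, left_log PM AG lam (Phi s \o Gam) f m (X s) &
        inf_action lam is_left act eps f m =
          - (2 * gam)^-1 * killing br eps (X true - X false)))
  /\
  (* c = i; Phi true, Phi false lift Delta_+- o pi^-1, their images are G_+- *)
  (mCYBE br (-1) Rop ->
   forall (GC : topGroupType) (AGC : smoothStructure R GC)
     (lamC : g * g -> (GC -> R) -> R) (iota : G -> GC),
   lie_group AGC ->
   lie_algebra_of AGC (brC br) lamC ->
   complex_group AGC lamC ->
   lie_group_hom AG AGC iota ->
   (forall X h, cinfty AGC h -> lam X (h \o iota) = lamC (X, 0) h) ->
   forall Phi : bool -> Gs -> GC,
   (forall s, lie_group_hom AGs AGC (Phi s)) ->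
   (forall s X h, cinfty AGC h ->
      lams (kappa_dual br X) (h \o Phi s) =
      lamC (gam *: (Rop X, sgn s *: X)) h) ->
   (exists2 N : bool -> bool -> M -> 'M[R[i]]_(\dim {:g}),
      forall s t i j, central PM (fun m => complex.Re (N s t m i j)) /\
                      central PM (fun m => complex.Im (N s t m i j)) &
      forall n (rho : GC -> 'M[R[i]]_n), rep AGC rho ->
        (forall Z, drep lamC rho (timesI Z) =
                   Complex 0 1 *: drep lamC rho Z) ->
        exchange_relations PM (Complex 0 1) gam R12 C12
          (fun i => drep lamC rho (bas i, 0))
          (fun s m => rho (Phi s (Gam m)))
          N)
   /\
   (forall eps f m, cinfty AM f ->
      exists2 Z : bool -> g * g,
        forall s, left_log PM AGC lamC (Phi s \o Gam) f m (Z s) &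
        real_complex R (inf_action lam is_left act eps f m) =
          - (2 * Complex 0 1 * real_complex R gam)^-1
            * killingC br (eps, 0) (Z true - Z false))).
Proof.
have sk := lie_algebra_skew hlam.
have [sact _ actM _] := hact.
pose D := dual_action lam is_left act C12.
have cD i f : cinfty AM f -> cinfty AM (D i f).
  exact: (cinfty_dual_action hG hlam is_left sact C12 i).
have Dcomm i j f m : cinfty AM f -> D i (D j f) m - D j (D i f) m =
    \sum_l D l f m * - (C12 *m ad_mx br (bas l)) i j.
  exact: (dual_action_comm hbr hG hlam sact actM hC12 i j).
have logG : log_derivative PM D AGs lams (fun i => kappa_dual br (bas i)) Gam.
  exact: (moment_map_log_derivative hbr hlam hC12 hGs hlams hGam).
have lin j : linear (fun eta : 'Hom(g, R^o) => eta (dual_bas C12 j) : R^o).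
  by move=> r u v; rewrite add_lfunE scale_lfunE.
(* Evaluation at the kappa-dual basis, which is dual to the forms kappa(e_i, .). *)
pose xi j : {linear 'Hom(g, R^o) -> R^o} :=
  HB.pack (fun eta : 'Hom(g, R^o) => eta (dual_bas C12 j) : R^o)
    (GRing.isLinear.Build _ _ _ _ _ (lin j)).
have xi_x i j : xi j (kappa_dual br (bas i)) = (i == j)%:R.
  by rewrite /xi /= (kappa_dualE hbr sk) (killing_sym hbr) (killing_dual_bas hbr sk hC12) coord_bas.
(* This tensor is fixed on the dual group, before the choice of case and of signs. *)
have [P [cP Psk PP]] := poisson_tensor_exists cD hGs hlams xi_x hGam.1 logG.
have sgnC s : real_complex R (sgn s) = sgn s by case: s; rewrite /sgn ?rmorphN rmorph1.
have oldelta eps f m : cinfty AM f ->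
    inf_action lam is_left act eps f m = - \sum_l killing br eps (bas l) * D l f m.
  exact: (inf_action_dual hbr hG hlam is_left sact hC12).
split=> hY.
- move=> Phi hPhi lamPhi.
  (* The image of kappa(e_i, .) under the differential of [Phi s]. *)
  pose x s i := gam *: (Rop (bas i) + sgn s *: bas i).
  have logK s : log_derivative PM D AG lam (x s) (Phi s \o Gam).
    exact: (log_derivative_hom logG hG (hPhi s) (fun i => lamPhi s (bas i))).
  split; last first.
    move=> eps f m Cf; exists (fun s => \sum_i D i f m *: x s i).
      by move=> s; exact: (left_log_sum m hG hlam (logK s) Cf).
    rewrite oldelta // -sumrB.
    (* [Rop] cancels in the difference of the two signs, leaving twice [gam] times each basis
       vector. *)
    have -> : \sum_i (D i f m *: x true i - D i f m *: x false i) =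
        \sum_i (2 * gam * D i f m) *: bas i.
      apply: eq_bigr => i _; rewrite -scalerBr /x -scalerBr /sgn opprD addrACA subrr add0r.
      rewrite scaleN1r opprK scale1r -mulr2n -scaler_nat !scalerA; congr (_ *: _).
      ring.
    rewrite (killing_sumr hbr sk) mulr_sumr -sumrN; apply: eq_bigr => i _.
    by field; rewrite hgam.
  have tenK s : poisson_tensor D AG lam (x s) (Phi s \o Gam) P.
    exact: (poisson_tensor_hom hG (hPhi s) (fun i => lamPhi s (bas i)) PP).
  have sGK s h : cinfty AG h -> cinfty AM (fun m => h ((Phi s \o Gam) m)).
    by move=> Ch; exact: (cinfty_comp hGam.1 (cinfty_comp (hPhi s).1 Ch)).
  pose r s t := if s == t then complexify R12
                else complexify R12 + (sgn s * 1) *: complexify C12.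
  have z_br X Y : real_coords (br X Y) = real_coords Y *m
      \matrix_(a, p) real_coords (br X (bas a)) 0 p.
    by apply: real_coords_map => c A B; exact: (br_linear hbr).
  have z_Ad y X : real_coords (Ad hG hlam y X) = real_coords X *m
      \matrix_(a, p) real_coords (Ad hG hlam y (bas a)) 0 p.
    by apply: real_coords_map => c A B; exact: Ad_linear.
  have admE X : \matrix_(a, p) real_coords (br X (bas a)) 0 p =
      map_mx (real_complex R) (ad_mx br X) by apply/matrixP => a p; rewrite !mxE.
  have r_id s t l : real_complex R gam *:
      ((\matrix_(a, p) real_coords (br (x s l) (bas a)) 0 p)^T *m r s t +
       r s t *m \matrix_(a, p) real_coords (br (x t l) (bas a)) 0 p) =
      (\matrix_(i, p) real_coords (x s i) 0 p)^T
        *m map_mx (real_complex R) (C12 *m ad_mx br (bas l))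
        *m \matrix_(i, p) real_coords (x t i) 0 p.
    have admE' u : map_mx (real_complex R) (ad_mx br (x u l)) = real_complex R gam *:
        (map_mx (real_complex R) (ad_mx br (Rop (bas l))) +
         (sgn u * 1) *: map_mx (real_complex R) (ad_mx br (bas l))).
      by rewrite (ad_mx_comb hbr sk) map_mxZ map_mxD map_mxZ mulr1 -sgnC.
    have ZE u : \matrix_(i, p) real_coords (x u i) 0 p = real_complex R gam *:
        (map_mx (real_complex R) (op_mx Rop) + (sgn u * 1) *: 1%:M).
      apply/matrixP => i p; rewrite !mxE linearZ linearD linearZ /= coord_bas.
      by rewrite mulr1 -sgnC rmorphM rmorphD rmorphM rmorph_nat.
    rewrite !admE !admE' !ZE; apply: scaled_identity.
    apply: (yang_baxter_matrix (c2 := 1)).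
    - by rewrite mulr1 rmorph1.
    - exact: (casimir_ad hbr sk hC12).
    - exact: (casimir_ad hbr sk hC12).
    - exact: (casimir_op hbr sk hskew hC12).
    - exact: (R12_casimir hR12 hC12).
    - exact: (mCYBE_mx hbr (bas l) hY).
  have [N [cN rN reN]] := exchange_relations_exist cD sk sGK cP Psk logK tenK Dcomm
    real_coords_linear z_br z_Ad r_id.
  (* All coordinates and [r] are real here, so the complex matrix [N] equals its real part. *)
  have NE s t m : N s t m = complexify (map_mx (@complex.Re R) (N s t m)).
    apply/matrixP => i j; rewrite !mxE.
    have := reN _ _ s t m i j; case: (N s t m i j) => u v /= -> //.
      by move=> X p; rewrite mxE.
    move=> s' t' i' j'; rewrite /r /complexify; case: ifP => _; rewrite !mxE //=.
    by rewrite mulr1 -sgnC /= mul0r mulr0 !addr0.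
  exists (fun s t m => map_mx (@complex.Re R) (N s t m)).
    by move=> s t i j; have [H _] := cN s t i j; under eq_fun do rewrite mxE.
  move=> n rho hrho s t m; rewrite -NE; apply: rN => // X.
  rewrite (real_expand (F := drep lam rho) X); last exact: (drep_linear hlam hrho).
  by apply: eq_bigr => a _; rewrite mxE.
- move=> GC AGC lamC iota hGC hlamC hcplx _ _ Phi hPhi lamPhi.
  pose I : R[i] := Complex 0 1.
  (* In the pair encoding of the complexification this is gamma (R + s i) applied to [bas i]. *)
  pose x s i : g * g := gam *: (Rop (bas i), sgn s *: bas i).
  have logK s : log_derivative PM D AGC lamC (x s) (Phi s \o Gam).
    exact: (log_derivative_hom logG hGC (hPhi s) (fun i => lamPhi s (bas i))).
  split; last first.
    move=> eps f m Cf; exists (fun s => \sum_i D i f m *: x s i).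
      by move=> s; exact: (left_log_sum m hGC hlamC (logK s) Cf).
    rewrite oldelta // -sumrB.
    have -> : \sum_i (D i f m *: x true i - D i f m *: x false i) =
        (0, \sum_i (2 * gam * D i f m) *: bas i).
      have E i : D i f m *: x true i - D i f m *: x false i =
          (0, (2 * gam * D i f m) *: bas i).
        rewrite -scalerBr /x -scalerBr /sgn scaleN1r scale1r.
        congr pair; rewrite /= ?subrr ?scaler0 // opprK -mulr2n -scaler_nat !scalerA.
        by congr (_ *: _); ring.
      under eq_bigr do rewrite E.
      elim: (index_enum _) => [|i s IH]; first by rewrite !big_nil.
      by rewrite !big_cons IH; congr pair; rewrite /= addr0.
    have k0 Y : killing br 0 Y = 0 by rewrite (killing_sym hbr) (killing0r hbr sk).
    rewrite /killingC /= !k0 (killing0r hbr sk) subr0 addr0 (killing_sumr hbr sk).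
    set S := \sum_l killing br eps (bas l) * D l f m.
    have -> : \sum_i 2 * gam * D i f m * killing br eps (bas i) = 2 * gam * S.
      by rewrite mulr_sumr; apply: eq_bigr => i _; ring.
    (* The pairing is purely imaginary; its factor i is the one in the prefactor, and the quotient
       is real. *)
    have -> : Complex 0 (2 * gam * S) = 2 * I * real_complex R gam * real_complex R S.
      apply/eqP; rewrite eq_complex /=; apply/andP; split; apply/eqP; ring.
    have n0 : 2 * I * real_complex R gam != 0.
      rewrite !mulf_neq0 ?pnatr_eq0 //; last by rewrite fmorph_eq0.
      by rewrite eq_complex /= oner_eq0 andbF.
    by rewrite rmorphN mulNr mulKf.
  have tenK s : poisson_tensor D AGC lamC (x s) (Phi s \o Gam) P.
    exact: (poisson_tensor_hom hGC (hPhi s) (fun i => lamPhi s (bas i)) PP).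
  have sGK s h : cinfty AGC h -> cinfty AM (fun m => h ((Phi s \o Gam) m)).
    by move=> Ch; exact: (cinfty_comp hGam.1 (cinfty_comp (hPhi s).1 Ch)).
  pose r s t := if s == t then complexify R12
                else complexify R12 + (sgn s * I) *: complexify C12.
  have brD X Y Z : br X (Y + Z) = br X Y + br X Z.
    by have := br_linear hbr X 1 Y Z; rewrite !scale1r.
  have br0 X : br X 0 = 0.
    by have := brD X 0 0; rewrite addr0 => /eqP; rewrite -subr_eq0 opprD addrA subrr sub0r
      oppr_eq0 => /eqP.
  have brN X Y : br X (- Y) = - br X Y.
    by have := br_linear hbr X (-1) Y 0; rewrite br0 !addr0 !scaleN1r.
  have z_br X Y : complex_coords (brC br X Y) = complex_coords Y *m
      \matrix_(a, p) complex_coords (brC br X (bas a, 0)) 0 p.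
    apply: complex_coords_map => [c A B|A]; rewrite /brC /timesI; congr pair; rewrite /=.
    - by rewrite !(br_linear hbr) scalerBr opprD addrACA.
    - by rewrite !(br_linear hbr) scalerDr addrACA.
    - by rewrite brN opprD.
    - by rewrite brN.
  have z_Ad y X : complex_coords (Ad hGC hlamC y X) = complex_coords X *m
      \matrix_(a, p) complex_coords (Ad hGC hlamC y (bas a, 0)) 0 p.
    apply: complex_coords_map => [c A B|A]; first exact: Ad_linear.
    (* [hcplx] is exactly complex linearity of the adjoint action, without which the coordinates of
       [(bas a, 0)] would not determine it. *)
    apply: Ad_unique => h Ch; apply: (hcplx y A (Ad hGC hlamC y A)) => // h' Ch'.
    by rewrite lam_Ad.
  have admE X : \matrix_(a, p) complex_coords (brC br X (bas a, 0)) 0 p =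
      map_mx (real_complex R) (ad_mx br X.1) + I *: map_mx (real_complex R) (ad_mx br X.2).
    apply/matrixP => a p; rewrite !mxE /= !br0 subr0 add0r.
    by apply/eqP; rewrite eq_complex /= !mul0r !mul1r subr0 addr0 !add0r !eqxx.
  have r_id s t l : real_complex R gam *:
      ((\matrix_(a, p) complex_coords (brC br (x s l) (bas a, 0)) 0 p)^T *m r s t +
       r s t *m \matrix_(a, p) complex_coords (brC br (x t l) (bas a, 0)) 0 p) =
      (\matrix_(i, p) complex_coords (x s i) 0 p)^T
        *m map_mx (real_complex R) (C12 *m ad_mx br (bas l))
        *m \matrix_(i, p) complex_coords (x t i) 0 p.
    have admE' u : \matrix_(a, p) complex_coords (brC br (x u l) (bas a, 0)) 0 p =
        real_complex R gam *:
        (map_mx (real_complex R) (ad_mx br (Rop (bas l))) +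
         (sgn u * I) *: map_mx (real_complex R) (ad_mx br (bas l))).
      rewrite admE /x /= !(ad_mxZ hbr sk) !map_mxZ -sgnC scalerDr !scalerA.
      by congr (_ + _ *: _); ring.
    have ZE u : \matrix_(i, p) complex_coords (x u i) 0 p = real_complex R gam *:
        (map_mx (real_complex R) (op_mx Rop) + (sgn u * I) *: 1%:M).
      apply/matrixP => i p; rewrite !mxE /= !linearZ /= coord_bas -sgnC.
      apply/eqP; rewrite eq_complex /=; apply/andP; split; apply/eqP;
        case: (i == p) => /=; ring.
    rewrite !admE' !ZE; apply: scaled_identity.
    apply: (yang_baxter_matrix (c2 := -1)).
    - by apply/eqP; rewrite eq_complex /= !mul0r mulr0 mulr1 sub0r addr0 !eqxx.
    - exact: (casimir_ad hbr sk hC12).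
    - exact: (casimir_ad hbr sk hC12).
    - exact: (casimir_op hbr sk hskew hC12).
    - exact: (R12_casimir hR12 hC12).
    - exact: (mCYBE_mx hbr (bas l) hY).
  have [N [cN rN _]] := exchange_relations_exist cD (lie_algebra_skew hlamC) sGK cP Psk
    logK tenK Dcomm complex_coords_linear z_br z_Ad r_id.
  exists N => // n rho hrho hI s t m; apply: rN => // X.
  rewrite (complex_expand (F := drep lamC rho) X); last 2 first.
  - exact: (drep_linear hlamC hrho).
  - exact: hI.
  by apply: eq_bigr => a _; rewrite mxE.
(* The canonical linear structure of [killing] leaves its hypotheses shelved. *)
Unshelve. all: assumption.
Qed.
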